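(* Let $k\ge4$ be an integer and let $\eta\in[\eta_{k+1},\eta_k)$. Then the vertices of the polygon $\mathrm{co}(K_\eta)$ are, in clockwise order, $b_0,z_0,z_1,\dots,z_k,w_1,\dots,w_k$.
   Context: For $\eta\in(0,\pi/3)$ let $a=\frac{e^{-i\eta}}{2\cos\eta}$ (so $|a|=\frac{1}{2\cos\eta}$), $f_1(z)=az$, $f_2(z)=1-\bar a z$, and let $K_\eta$ be the unique nonempty compact set with $K_\eta=f_1(K_\eta)\cup f_2(K_\eta)$. Let $c=\frac{1}{1-|a|^4}$ and for integers $j\ge0$ put $z_j=ca^{j+1}$, $w_j=1-c|a|^2a^j$, $b_j=a+c|a|^4a^j$. For integers $k\ge 1$ define $\Phi_k(\eta)=(1-|a|^4)\sin((k-1)\eta)-|a|^3\sin((k-2)\eta)+|a|^k\sin\eta$ (with $|a|=1/(2\cos\eta)$). For each integer $k\ge4$, $\Phi_k$ has a unique zero in the interval $(\pi/k,\pi/(k-1))$, denoted $\eta_k$. *)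

(* Defs.v *)
(* The complex plane is modelled as R * R
   (real part, imaginary part), with the product topology. *)
From HB Require Import structures.
From mathcomp Require Import all_boot all_order all_algebra.
From mathcomp Require Import all_classical all_reals all_analysis.
Set Implicit Arguments. Unset Strict Implicit. Unset Printing Implicit Defensive.
Import Order.TTheory GRing.Theory Num.Theory.
Import numFieldNormedType.Exports.
Local Open Scope classical_set_scope.
Local Open Scope ring_scope.

Section Defs.
Variable R : realType.
Notation pt := (R * R)%type.

Definition cadd (z w : pt) : pt := (z.1 + w.1, z.2 + w.2).
Definition csub (z w : pt) : pt := (z.1 - w.1, z.2 - w.2).
Definition cmul (z w : pt) : pt := (z.1 * w.1 - z.2 * w.2, z.1 * w.2 + z.2 * w.1).
Definition cconj (z : pt) : pt := (z.1, - z.2).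
Definition creal (x : R) : pt := (x, 0).
Fixpoint cpow (z : pt) (n : nat) : pt :=
  if n is m.+1 then cmul z (cpow z m) else creal 1.

Definition absa (eta : R) : R := 1 / (2 * cos eta).
(* a = e^{-i eta} / (2 cos eta) *)
Definition a_of (eta : R) : pt := (cos eta * absa eta, - sin eta * absa eta).
Definition f1 (eta : R) (z : pt) : pt := cmul (a_of eta) z.
Definition f2 (eta : R) (z : pt) : pt := csub (creal 1) (cmul (cconj (a_of eta)) z).

Definition c_of (eta : R) : R := 1 / (1 - absa eta ^+ 4).
Definition zj (eta : R) (j : nat) : pt := cmul (creal (c_of eta)) (cpow (a_of eta) j.+1).
Definition wj (eta : R) (j : nat) : pt :=
  csub (creal 1) (cmul (creal (c_of eta * absa eta ^+ 2)) (cpow (a_of eta) j)).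
Definition bj (eta : R) (j : nat) : pt :=
  cadd (a_of eta) (cmul (creal (c_of eta * absa eta ^+ 4)) (cpow (a_of eta) j)).

Definition Phi (k : nat) (eta : R) : R :=
  (1 - absa eta ^+ 4) * sin ((k%:R - 1) * eta)
  - absa eta ^+ 3 * sin ((k%:R - 2) * eta)
  + absa eta ^+ k * sin eta.

Definition segpt (t : R) (x y : pt) : pt :=
  (t * x.1 + (1 - t) * y.1, t * x.2 + (1 - t) * y.2).
Definition convex_pt (C : set pt) : Prop :=
  forall x y t, C x -> C y -> 0 <= t <= 1 -> C (segpt t x y).
Definition conv_hull (A : set pt) : set pt :=
  \bigcap_(C in [set C | convex_pt C /\ A `<=` C]) C.
Definition extreme_pt (S : set pt) (x : pt) : Prop :=
  S x /\ forall y z t, S y -> S z -> 0 < t < 1 -> x = segpt t y z -> y = z.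

Definition cross (o p q : pt) : R :=
  (p.1 - o.1) * (q.2 - o.2) - (p.2 - o.2) * (q.1 - o.1).

(* [polygon_cw S ps]: S is a (convex) polygon whose vertices are exactly
   the points of ps, listed in clockwise order: for each (cyclic) edge
   p_i -> p_{i+1}, every other listed vertex lies strictly to its right. *)
Definition polygon_cw (S : set pt) (ps : seq pt) : Prop :=
  let n := size ps in
  let p i := nth (0, 0) ps i in
  [/\ (3 <= n)%N,
      S = conv_hull [set x | x \in ps],
      extreme_pt S = [set x | x \in ps] &
      forall i j, (i < n)%N -> (j < n)%N -> j != i -> j != (i.+1 %% n)%N ->
        cross (p i) (p (i.+1 %% n)%N) (p j) < 0].

Definition vertex_list (eta : R) (k : nat) : seq pt :=
  bj eta 0 :: [seq zj eta j | j <- iota 0 k.+1] ++ [seq wj eta j | j <- iota 1 k].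

End Defs.

(* Main.v *)
(** Write [h_t z = Im (e^{it} z)].  The maps act on these linear functionals by
    [h_t (f1 z) = |a| h_{t-eta} z] and
    [h_t (f2 z) = sin t + |a| h_{t+eta+pi} z].
    The edges of the announced polygon have the clockwise angles [pi - eta],
    [pi + j eta] (between the [z_j]), [A] (from [z_k] to [w_1]), [2 pi + i eta]
    (between the [w_j]) and [A + pi - eta] (from [w_k] to [b_0], the image under
    [f2] of the edge from [z_k] to [w_1]).  The signs of [Phi_k] and
    [Phi_{k+1}] at [eta] say exactly that [pi + (k-1) eta < A <= pi + k eta];
    moreover [2 pi - eta <= A < 2 pi].  Hence the angles increase, and the
    polygon is the intersection of its edge half-planes.  Shifting an edge angle
    by [-eta] or [eta + pi] lands in the normal cone of a known vertex, so
    [f1] and [f2] map the polygon into itself; as they contract, it contains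
    [K].  Conversely [z_0] is the fixed point of [f2 f2 f1 f1], and all other
    vertices are images of [z_0], so they belong to [K]. *)

Require Import Defs.
From HB Require Import structures.
From mathcomp Require Import all_boot all_order all_algebra.
From mathcomp Require Import all_classical all_reals all_analysis.
From mathcomp Require Import zify ring lra.
Set Implicit Arguments. Unset Strict Implicit. Unset Printing Implicit Defensive.
Import Order.TTheory GRing.Theory Num.Theory.
Import numFieldNormedType.Exports.
Local Open Scope classical_set_scope.
Local Open Scope ring_scope.
Local Notation cadd := Defs.cadd.

(** * Clockwise polygons given by edge angles *)

Section Polygon.
Context {R : realType}.
Local Notation pt := (R * R)%type.
Implicit Types (t u : R) (x y z : pt).

(* [polar rho t] is rho e^{-it}: angles are measured clockwise. *)
Definition polar rho t : pt := (rho * cos t, - (rho * sin t)).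

(* [height t z] is Im (e^{it} z), the outward functional of a clockwise edge
   directed along e^{-it}. *)
Definition height t z : R := sin t * z.1 + cos t * z.2.

Lemma height_polar t rho u : height t (polar rho u) = rho * sin (t - u).
Proof. by rewrite /height /polar /= sinB; ring. Qed.

Lemma heightD t x y : height t (cadd x y) = height t x + height t y.
Proof. by rewrite /height /cadd /=; ring. Qed.

Lemma height_segpt t s x y :
  height t (segpt s x y) = s * height t x + (1 - s) * height t y.
Proof. by rewrite /height /segpt /=; ring. Qed.

Lemma heightD2pi t z : height (t + pi *+ 2) z = height t z.
Proof. by rewrite /height sinD2pi cosD2pi. Qed.

(** For u <= t <= v < u + pi both coefficients are nonnegative, so bounds at the two edge angles of
    a vertex extend to its normal cone. *)
Lemma height_cone t u v z :
  sin (v - u) * height t z = sin (v - t) * height u z + sin (t - u) * height v z.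
Proof.
by rewrite /height !sinB; ring.
Qed.

Lemma height2_inj t u x y : sin (u - t) != 0 ->
  height t x = height t y -> height u x = height u y -> x = y.
Proof.
case: x y => [x1 x2] [y1 y2]; rewrite /height sinB /= => /eqP d0 ht hu.
have e1 : (sin u * cos t - cos u * sin t) * (x1 - y1) = 0.
  rewrite mulrBl mulrBr; apply: (@eq_trans _ _ (cos t * ((sin u * x1 + cos u * x2) - (sin u * y1 + cos u * y2))
    - cos u * ((sin t * x1 + cos t * x2) - (sin t * y1 + cos t * y2)))); first by ring.
  by rewrite ht hu; ring.
have e2 : (sin u * cos t - cos u * sin t) * (x2 - y2) = 0.
  apply: (@eq_trans _ _ (sin u * ((sin t * x1 + cos t * x2) - (sin t * y1 + cos t * y2))
    - sin t * ((sin u * x1 + cos u * x2) - (sin u * y1 + cos u * y2)))); first by ring.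
  by rewrite ht hu; ring.
by move/eqP: e1; rewrite mulf_eq0 => /orP[/eqP//|/eqP e1];
  move/eqP: e2; rewrite mulf_eq0 => /orP[/eqP//|/eqP e2]; congr (_, _); lra.
Qed.

Lemma cross_height x y z rho t : y = cadd x (polar rho t) ->
  cross x y z = rho * (height t z - height t x).
Proof. by move=> ->; rewrite /cross /height /cadd /polar /=; ring. Qed.

Lemma sin_lt0_Npi t : - pi < t < 0 -> sin t < 0.
Proof.
by move=> ht; rewrite -(opprK t) sinN oppr_lt0; apply: sin_gt0_pi; lra.
Qed.

Lemma sin_le0_Npi t : - pi <= t <= 0 -> sin t <= 0.
Proof.
by move=> ht; rewrite -(opprK t) sinN oppr_le0; apply: sin_ge0_pi; lra.
Qed.

(** * Convex hulls, extreme points and triangles *)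

Lemma conv_hull_convex (A : set pt) : convex_pt (conv_hull A).
Proof.
move=> x y t hx hy ht C [hC AC].
by apply: (hC) => //; [exact: (hx C (conj hC AC))|exact: (hy C (conj hC AC))].
Qed.

Lemma sub_conv_hull (A : set pt) : A `<=` conv_hull A.
Proof. by move=> x Ax C [_]; apply. Qed.

Lemma conv_hull_sub (A C : set pt) :
  convex_pt C -> A `<=` C -> conv_hull A `<=` C.
Proof. by move=> hC AC x; apply. Qed.

(** Removing an extreme point leaves the hull convex; were the point outside [A], the smaller set
    would still contain [A], against the minimality of the hull. *)
Lemma extreme_conv_hull (A : set pt) : extreme_pt (conv_hull A) `<=` A.
Proof.
move=> x [hx xP]; apply: contrapT => nAx.
suff : (conv_hull A `\ x) x by move=> [_]; apply.
apply: (hx (conv_hull A `\ x)); split; last first.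
  by move=> y Ay; split; [exact: sub_conv_hull|move=> /= e; rewrite e in Ay].
move=> y z t [hy yx] [hz zx] t01; split; first exact: conv_hull_convex.
move=> /= e.
case: y z hy yx hz zx e => [y1 y2] [z1 z2] hy yx hz zx e.
have [t0|t0] := eqVneq t 0.
  by apply: zx; rewrite /= -e t0 /segpt /=; congr (_, _); ring.
have [t1|t1] := eqVneq t 1.
  by apply: yx; rewrite /= -e t1 /segpt /=; congr (_, _); ring.
have yz : (y1, y2) = (z1, z2).
  by apply: (xP _ _ t) => //; rewrite !lt_neqAle eq_sym t0 t1.
by apply: yx; rewrite /= -e -yz /segpt /=; congr (_, _); ring.
Qed.

(** The barycentric coordinates k, m, l of z at a, b, c are ratios of signed areas; the assumed
    signs make them nonnegative. *)
Lemma convex_triangle (C : set pt) a b c z : convex_pt C ->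
  C a -> C b -> C c -> cross a b c < 0 ->
  cross a b z <= 0 -> cross b c z <= 0 -> 0 <= cross a c z -> C z.
Proof.
move=> hC Ca Cb Cc Dlt0 h1 h2 h3.
pose D := cross a b c.
have D0 : D != 0 by rewrite lt_eqF.
pose l := cross a b z / D; pose m := - cross a c z / D; pose k := cross b c z / D.
have l0 : 0 <= l by rewrite /l ler_ndivlMr // mul0r.
have m0 : 0 <= m by rewrite /m ler_ndivlMr // mul0r oppr_le0.
have k0 : 0 <= k by rewrite /k ler_ndivlMr // mul0r.
have s1 : l + m + k = 1.
  rewrite /l /m /k -!mulrDl; apply: (mulIf D0); rewrite divfK // mul1r.
  by rewrite /D /cross; ring.
have z1 : z.1 = k * a.1 + m * b.1 + l * c.1.
  have e : D * z.1 = cross b c z * a.1 - cross a c z * b.1 + cross a b z * c.1.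
    by rewrite /D /cross; ring.
  by apply: (mulfI D0); rewrite e /l /m /k; field.
have z2 : z.2 = k * a.2 + m * b.2 + l * c.2.
  have e : D * z.2 = cross b c z * a.2 - cross a c z * b.2 + cross a b z * c.2.
    by rewrite /D /cross; ring.
  by apply: (mulfI D0); rewrite e /l /m /k; field.
have [kle|kgt] := leP 1 k.
  have l00 : l = 0 by lra.
  have m00 : m = 0 by lra.
  have k1 : k = 1 by lra.
  suff -> : z = a by [].
  by case: (z) (a) z1 z2 => ? ? [? ?] /= -> ->; rewrite l00 m00 k1; congr (_, _); ring.
have k1 : 1 - k != 0 by rewrite subr_eq0 gt_eqF.
suff -> : z = segpt k a (segpt (m / (1 - k)) b c).
  apply: (hC) => //; last by rewrite k0 ltW.
  apply: (hC) => //; rewrite divr_ge0 ?subr_ge0 ?(ltW kgt) //=.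
  by rewrite ler_pdivrMr ?subr_gt0 // mul1r; lra.
rewrite /segpt /= [LHS]surjective_pairing z1 z2.
have -> : l = 1 - k - m by lra.
by congr (_, _); field.
Qed.

(** * Closed walks that turn clockwise once around *)

Section Clockwise.
Variables (ps : seq pt) (al rho : nat -> R).
Local Notation n := (size ps).
Local Notation p i := (nth (0, 0) ps i).

Hypothesis n3 : (3 <= n)%N.
Hypothesis rho_gt0 : forall i, (i < n)%N -> 0 < rho i.
Hypothesis edge : forall i, (i < n)%N ->
  p (i.+1 %% n)%N = cadd (p i) (polar (rho i) (al i)).
(** Every turn is strictly between 0 and pi, and [al_wrap] closes the walk after exactly one
    revolution. *)
Hypothesis al_step : forall i, (i.+1 < n)%N -> al i < al i.+1 < al i + pi.
Hypothesis al_wrap : al n.-1 < al 0 + pi *+ 2 < al n.-1 + pi.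

Definition halfplanes : set pt :=
  [set z | forall i, (i < n)%N -> height (al i) z <= height (al i) (p i)].

(** Vertices continue periodically and angles gain 2 pi per lap, so that the cyclic order becomes
    the order of the natural numbers. *)
Let q m := p (m %% n)%N.
Let be m := al (m %% n)%N + pi *+ 2 *+ (m %/ n).
Let n_gt0 : (0 < n)%N. Proof. exact: leq_trans n3. Qed.

Let modn_succ m :
  ((m.+1 %% n)%N = (m %% n).+1 /\ (m.+1 %/ n)%N = (m %/ n)%N /\
   ((m %% n).+1 < n)%N) \/
  ((m.+1 %% n)%N = 0%N /\ (m.+1 %/ n)%N = (m %/ n).+1 /\ ((m %% n)%N = n.-1)).
Proof.
have hm : (m %% n < n)%N by rewrite ltn_pmod.
have e : (n %| m.+1)%N = ((m %% n).+1 == n).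
  rewrite /dvdn -addn1 -modnDml addn1.
  have [->|ne] := eqVneq (m %% n).+1 n; first by rewrite modnn.
  by rewrite modn_small // ltn_neqAle ne.
rewrite modnS divnS // e; have [E|ne] := eqVneq (m %% n).+1 n; [right|left].
  by rewrite -[X in X.-1]E.
by rewrite ltn_neqAle ne.
Qed.

Let q_step m : q m.+1 = cadd (q m) (polar (rho (m %% n)%N) (be m)).
Proof.
rewrite /q /be /polar (periodicn (@sinD2pi R)) (periodicn (@cosD2pi R)).
rewrite -edge ?ltn_pmod //.
by congr (nth _ _ _); rewrite -addn1 -[in RHS]addn1 modnDml.
Qed.

Let q_period m : q (m + n) = q m.
Proof. by rewrite /q modnDr. Qed.

Let be_period m : be (m + n) = be m + pi *+ 2.
Proof.
rewrite /be modnDr divnDr ?dvdnn // divnn n_gt0 addn1 mulrSr addrA //.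
Qed.

Let be_step m : be m < be m.+1 < be m + pi.
Proof.
rewrite /be; have [[-> [-> h]]|[-> [-> h]]] := modn_succ m.
  by have := al_step h; lra.
by rewrite h mulrSr; have := al_wrap; lra.
Qed.

Let be_lt i j : (i < j)%N -> be i < be j.
Proof.
elim: j => // j IH; rewrite ltnS leq_eqVlt => /orP[/eqP ->|/IH h];
  have := be_step j; lra.
Qed.

Let be_le i j : (i <= j)%N -> be i <= be j.
Proof. by rewrite leq_eqVlt => /orP[/eqP ->//|/be_lt/ltW]. Qed.

Let height_q t m : height t (q m.+1) = height t (q m) + rho (m %% n)%N * sin (t - be m).
Proof. by rewrite q_step heightD height_polar. Qed.

(** The walk from i to j uses the edges i, ..., j - 1; their angles lie in (t, t + pi), where each
    edge lowers the height at t. *)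
Let descent t i j : (i < j)%N -> t < be i -> be j.-1 < t + pi ->
  height t (q j) < height t (q i).
Proof.
elim: j => // j IH; rewrite ltnS leq_eqVlt => /orP[/eqP <-|ij] hi hj;
  have rj := rho_gt0 (ltn_pmod j n_gt0);
  have si := rho_gt0 (ltn_pmod i n_gt0).
  rewrite height_q -[ltRHS]addr0 ltrD2l pmulr_rlt0 //.
  by apply: sin_lt0_Npi; move: hj => /=; lra.
rewrite height_q.
have := be_lt ij; have : be j.-1 <= be j by apply: be_le; rewrite leq_pred.
move=> h1 h2; have := IH ij hi (le_lt_trans h1 hj).
suff : rho (j %% n)%N * sin (t - be j) < 0 by lra.
by rewrite pmulr_rlt0 //; apply: sin_lt0_Npi; move: hj => /=; lra.
Qed.

Let ascent t i j : (i < j)%N -> t + pi < be i -> be j.-1 < t + pi *+ 2 ->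
  height t (q i) < height t (q j).
Proof.
have sgt u : t + pi < u -> u < t + pi *+ 2 -> 0 < sin (t - u).
  by move=> h1 h2; rewrite -sinD2pi; apply: sin_gt0_pi; lra.
elim: j => // j IH; rewrite ltnS leq_eqVlt => /orP[/eqP <-|ij] hi hj;
  have rj := rho_gt0 (ltn_pmod j n_gt0);
  have si := rho_gt0 (ltn_pmod i n_gt0).
  rewrite height_q -[ltLHS]addr0 ltrD2l pmulr_rgt0 //.
  by apply: sgt; move: hj => /=; lra.
rewrite height_q.
have := be_lt ij; have : be j.-1 <= be j by apply: be_le; rewrite leq_pred.
move=> h1 h2; have := IH ij hi (le_lt_trans h1 hj).
suff : 0 < rho (j %% n)%N * sin (t - be j) by lra.
by rewrite pmulr_rgt0 //; apply: sgt; move: hj => /=; lra.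
Qed.

Let height_edge i : height (be i) (q i.+1) = height (be i) (q i).
Proof. by rewrite height_q subrr sin0 mulr0 addr0. Qed.

(* Along the polygon the height of an edge decreases as long as the edges
   turn by less than pi, and increases afterwards. *)
Let strict_right i j : (i.+1 < j)%N -> (j < i + n)%N ->
  height (be i) (q j) < height (be i) (q i).
Proof.
move=> ij jn; have ii := be_lt (ltnSn i).
have [h|h] := ltP (be j.-1) (be i + pi).
  by rewrite -(height_edge i); exact: descent.
rewrite -(q_period i); apply: ascent => //.
  by apply: le_lt_trans h _; apply: be_lt; lia.
by rewrite -be_period; apply: be_lt; lia.
Qed.

Lemma height_lt i j : (i < n)%N -> (j < n)%N -> j != i -> j != (i.+1 %% n)%N ->
  height (al i) (p j) < height (al i) (p i).
Proof.
move=> hi hj ji ji1.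
have bi : be i = al i by rewrite /be modn_small // divn_small // mulr0n addr0.
have qi m : (m < n)%N -> q m = p m by move=> hm; rewrite /q modn_small.
rewrite -bi -(qi i) // -(qi j) //.
move: ji; rewrite neq_ltn => /orP[ji|ij].
  rewrite -(q_period j); apply: strict_right; last by lia.
  have [e|ne] := eqVneq i.+1 n; last by lia.
  by move: ji1; rewrite e modnn; lia.
apply: strict_right; last by lia.
by move: ji1; rewrite modn_small; lia.
Qed.

Lemma height_nextE i : (i < n)%N ->
  height (al i) (p (i.+1 %% n)%N) = height (al i) (p i).
Proof. by move=> hi; rewrite edge // heightD height_polar subrr sin0 mulr0 addr0. Qed.

Lemma vertex_halfplanes i : (i < n)%N -> halfplanes (p i).
Proof.
move=> hi j hj; have [->//|ij] := eqVneq i j.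
have [->|ij1] := eqVneq i (j.+1 %% n)%N; first by rewrite height_nextE.
exact/ltW/height_lt.
Qed.

Lemma halfplanes_convex : convex_pt halfplanes.
Proof.
move=> x y t hx hy /andP[t0 t1] i hi; rewrite height_segpt.
have := hx i hi; have := hy i hi; nra.
Qed.

Lemma cross_lt0 i j : (i < n)%N -> (j < n)%N -> j != i -> j != (i.+1 %% n)%N ->
  cross (p i) (p (i.+1 %% n)%N) (p j) < 0.
Proof.
move=> hi hj ji ji1; rewrite (cross_height _ (edge hi)).
by rewrite pmulr_rlt0 ?rho_gt0 // subr_lt0 height_lt.
Qed.

(** Both edge lines pass through [p i.+1], and by [height_cone] the height at t is, up to a positive
    factor, a nonnegative combination of theirs. *)
Lemma halfplanes_cone i t z : (i.+1 < n)%N -> al i <= t <= al i.+1 ->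
  halfplanes z -> height t z <= height t (p i.+1).
Proof.
move=> hi /andP[ht1 ht2] hz; have := al_step hi => /andP[s1 s2].
have s0 : 0 < sin (al i.+1 - al i) by apply: sin_gt0_pi; lra.
rewrite -(ler_pM2l s0) !(height_cone t (al i) (al i.+1)).
have e := height_nextE (ltnW hi); rewrite modn_small // in e.
apply: lerD; apply: ler_wpM2l.
- by apply: sin_ge0_pi; lra.
- by rewrite e; apply: hz; apply: ltnW.
- by apply: sin_ge0_pi; lra.
- exact: hz.
Qed.

Lemma halfplanes_cone_wrap t z : al n.-1 <= t <= al 0 + pi *+ 2 ->
  halfplanes z -> height t z <= height t (p 0).
Proof.
move=> /andP[ht1 ht2] hz; have := al_wrap => /andP[s1 s2].
have hn : (n.-1 < n)%N by rewrite prednK.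
have s0 : 0 < sin (al 0 + pi *+ 2 - al n.-1) by apply: sin_gt0_pi; lra.
rewrite -(ler_pM2l s0) !(height_cone t (al n.-1) (al 0 + pi *+ 2)).
have e := height_nextE hn; rewrite prednK // modnn in e.
apply: lerD; apply: ler_wpM2l.
- by apply: sin_ge0_pi; lra.
- by rewrite e; apply: hz.
- by apply: sin_ge0_pi; lra.
- by rewrite !heightD2pi; exact: hz.
Qed.

(* A point of the half-planes lies in one triangle of the fan from [p 0]. *)
Lemma halfplanes_hull : halfplanes = conv_hull [set x | x \in ps].
Proof.
apply/seteqP; split; last first.
  apply: conv_hull_sub; first exact: halfplanes_convex.
  move=> x /= xps; rewrite -(nth_index (0, 0) xps); apply: vertex_halfplanes.
  by rewrite index_mem.
move=> z hz.
have mem i : (i < n)%N -> conv_hull [set x | x \in ps] (p i).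
  by move=> hi; apply: sub_conv_hull; rewrite /= mem_nth.
have cz i : (i < n)%N -> cross (p i) (p (i.+1 %% n)%N) z <= 0.
  move=> hi; rewrite (cross_height _ (edge hi)).
  by rewrite pmulr_rle0 ?rho_gt0 // subr_le0 hz.
(* The triangle sits where the sign of [cross (p 0) (p i) z] changes between i = 1 and i = n - 1. *)
have : exists2 i, (0 < i)%N && (i.+1 < n)%N &
    cross (p 0) (p i) z <= 0 /\ 0 <= cross (p 0) (p i.+1) z.
  have c1 : cross (p 0) (p 1) z <= 0.
    by have := cz 0%N n_gt0; rewrite modn_small // (leq_trans _ n3).
  have cn : 0 <= cross (p 0) (p n.-1) z.
    have : cross (p n.-1) (p 0) z <= 0.
      by have := cz n.-1; rewrite prednK // modnn; apply.
    by rewrite /cross; lra.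
  apply: contrapT => nex.
  (* Without such a change the negative sign propagates to n - 1. It is strict only from i = 2 on,
     since z may lie on the line through [p 0] and [p 1]. *)
  have step i : (0 < i)%N -> (i < n)%N -> cross (p 0) (p i) z <= 0 /\ ((1 < i)%N -> cross (p 0) (p i) z < 0).
    elim: i => // -[|i] IH _ hi; first by split.
    have [IH1 _] := IH isT (ltnW hi).
    suff h : cross (p 0) (p i.+2) z < 0 by split=> //; exact: ltW.
    rewrite ltNge; apply/negP => h; apply: nex.
    by exists i.+1.
  have [_] : cross (p 0) (p n.-1) z <= 0 /\ ((1 < n.-1)%N -> cross (p 0) (p n.-1) z < 0).
    by apply: step; lia.
  by rewrite ltNge cn; move=> /(_ ltac:(lia)).
case=> i /andP[i0 i1] [h1 h2].
apply: (@convex_triangle _ (p 0) (p i) (p i.+1)) => //.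
- exact: conv_hull_convex.
- exact: mem.
- by apply: mem; lia.
- exact: mem.
- have := @cross_lt0 i 0 (ltnW i1) n_gt0; rewrite modn_small // => h.
  suff : cross (p i) (p i.+1) (p 0) < 0 by rewrite /cross; lra.
  by apply: h; lia.
- by have := cz i (ltnW i1); rewrite modn_small.
Qed.

(** A vertex maximises the heights of both its edges, so these agree at the ends of any segment with
    the vertex inside; two independent heights determine a point. *)
Lemma vertex_extreme i : (i < n)%N -> extreme_pt halfplanes (p i).
Proof.
move=> hi; split=> [|y z t hy hz /andP[t0 t1] e]; first exact: vertex_halfplanes.
have key u : height u y <= height u (p i) -> height u z <= height u (p i) ->
    height u y = height u z.
  by rewrite e height_segpt => h1 h2; apply/eqP; rewrite eq_le; apply/andP; split; nra.
have k1 : height (al i) y = height (al i) z by apply: key; [exact: hy|exact: hz].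
case: i hi e key k1 => [|i] hi e key k1.
  have hn : (n.-1 < n)%N by rewrite prednK.
  apply: (@height2_inj (al n.-1) (al 0 + pi *+ 2)).
  - by rewrite gt_eqF //; apply: sin_gt0_pi; have := al_wrap; lra.
  - have E := height_nextE hn; rewrite prednK // modnn in E.
    by apply: key; rewrite E; [exact: hy|exact: hz].
  - by rewrite !heightD2pi.
apply: (@height2_inj (al i) (al i.+1)) => //.
- by rewrite gt_eqF //; apply: sin_gt0_pi; have := al_step hi; lra.
- have E := height_nextE (ltnW hi); rewrite modn_small // in E.
  by apply: key; rewrite E; [apply: hy; exact: ltnW|apply: hz; exact: ltnW].
Qed.

Lemma polygon_cw_halfplanes : polygon_cw halfplanes ps.
Proof.
split => //.
- exact: halfplanes_hull.
- apply/seteqP; split; first by rewrite halfplanes_hull; exact: extreme_conv_hull.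
  move=> x /= xps; rewrite -(nth_index (0, 0) xps).
  by apply: vertex_extreme; rewrite index_mem.
- exact: cross_lt0.
Qed.

End Clockwise.
End Polygon.

(** * Signs of Phi *)

Section Phi_sign.
Context {R : realType}.
Implicit Types (x y e : R).

(** * Trigonometric bounds and the size of |a| *)

Lemma ler_sin_pihalf x y : 0 <= x -> x <= y -> y <= pi / 2 -> sin x <= sin y.
Proof.
move=> x0 xy yp; rewrite leNgt; apply/negP => h.
have hx : x \in `[- (pi / 2), pi / 2 : R] by rewrite in_itv /=; lra.
have hy : y \in `[- (pi / 2), pi / 2 : R] by rewrite in_itv /=; lra.
by move: h; rewrite ltr_sin //; lra.
Qed.

Lemma ltr_cos_0pi x y : 0 <= x -> x < y -> y <= pi -> cos y < cos x.
Proof. by move=> x0 xy yp; rewrite ltr_cos // in_itv /=; lra. Qed.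

Lemma sin_le_obtuse x y : pi / 2 <= x -> x <= y -> y <= pi -> sin y <= sin x.
Proof.
move=> px xy yp; have -> : sin y = sin (pi - y) by rewrite sinB sinpi cospi; ring.
have -> : sin x = sin (pi - x) by rewrite sinB sinpi cospi; ring.
by apply: ler_sin_pihalf; lra.
Qed.

Lemma cos_pi3 : cos (pi / 3) = 1 / 2 :> R.
Proof.
have pi0 := pi_gt0 R.
have s0 : 0 < sin (pi / 3 : R) by apply: sin_gt0_pi; lra.
have c0 : 0 < cos (pi / 3 : R) by apply: cos_gt0_pihalf; lra.
have : sin (pi / 3 + pi / 3 + pi / 3) = 0 :> R.
  by rewrite -(sinpi R); congr sin; field.
rewrite !sinD !cosD; have := cos2Dsin2 (pi / 3 : R).
set c := cos _ in c0 *; set s := sin _ in s0 *; move=> e1 e2.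
have e3 : s * (3 * c ^+ 2 - s ^+ 2) = 0 by rewrite -[RHS]e2; ring.
move/eqP: e3; rewrite mulf_eq0 gt_eqF //= => /eqP e3.
nra.
Qed.

Lemma sin_eta_gt0 e (e_bd : 0 < e < pi / 3) : 0 < sin e.
Proof. by apply: sin_gt0_pi; have := pi_gt0 R; lra. Qed.

Lemma cos_eta_gt e (e_bd : 0 < e < pi / 3) : 1 / 2 < cos e.
Proof. by rewrite -cos_pi3; apply: ltr_cos_0pi; have := pi_gt0 R; lra. Qed.

Lemma cos_etaE e (e_bd : 0 < e < pi / 3) : 2 * absa e * cos e = 1.
Proof.
have h := (cos_eta_gt e_bd); rewrite /absa; field.
by rewrite gt_eqF //; lra.
Qed.

Lemma absa_gt0 e (e_bd : 0 < e < pi / 3) : 0 < absa e.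
Proof. by have := (cos_eta_gt e_bd); have := (cos_etaE e_bd); nra. Qed.

Lemma absa_lt1 e (e_bd : 0 < e < pi / 3) : absa e < 1.
Proof. by have := (cos_eta_gt e_bd); have := (cos_etaE e_bd); have := (absa_gt0 e_bd); nra. Qed.

Lemma absa_neq0 e (e_bd : 0 < e < pi / 3) : absa e != 0.
Proof. by rewrite gt_eqF // (absa_gt0 e_bd). Qed.

Lemma absa_sqr_le e (e_bd : 0 < e < pi / 3) : e <= pi / 4 -> absa e ^+ 2 <= 1 / 2.
Proof.
move=> e4; have : 0 <= cos (e *+ 2).
  by apply: cos_ge0_pihalf; have := pi_gt0 R; lra.
rewrite cos_mulr2n => h; have := (cos_etaE e_bd); have := (absa_gt0 e_bd) => r0 e1.
have : (2 * absa e * cos e) ^+ 2 = 1 by rewrite e1; ring.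
nra.
Qed.

Lemma absaX_le e (e_bd : 0 < e < pi / 3) :
  e <= pi / 4 -> absa e ^+ 2 <= 1 / 2 /\ absa e ^+ 4 <= 1 / 4.
Proof.
move=> h; have r2 := absa_sqr_le e_bd h; split => //.
have : 0 <= absa e ^+ 2 by rewrite exprn_ge0 // ltW // absa_gt0.
by rewrite (exprM _ 2 2); nra.
Qed.

(** The sum formula with 2 |a| cos e = 1; this three-term recurrence eliminates cos e from the later
    computations. *)
Lemma sin_rec e (e_bd : 0 < e < pi / 3) x : sin x = absa e * (sin (x + e) + sin (x - e)).
Proof.
rewrite sinD sinB (_ : absa e * _ = (2 * absa e * cos e) * sin x); last by ring.
by rewrite (cos_etaE e_bd) mul1r.
Qed.

Lemma sin2_etaE e (e_bd : 0 < e < pi / 3) : sin (2 * e) = sin e / absa e.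
Proof.
apply: (mulIf (absa_neq0 e_bd)); rewrite divfK ?(absa_neq0 e_bd) //.
rewrite (sin_rec e_bd e) (_ : e - e = 0); last by ring.
by rewrite sin0 (_ : 2 * e = e + e); ring.
Qed.

(** * Sign changes of Phi *)

Lemma absa_lt e1 e2 : 0 < e1 -> e1 < e2 -> e2 < pi / 3 -> absa e1 < absa e2.
Proof.
move=> e0 e12 e2p; have pi0 := pi_gt0 R.
have h1 : 0 < e1 < pi / 3 by lra.
have h2 : 0 < e2 < pi / 3 by lra.
have : cos e2 < cos e1 by apply: ltr_cos_0pi; lra.
have := cos_etaE h1; have := cos_etaE h2.
have := absa_gt0 h1; have := absa_gt0 h2; have := cos_eta_gt h2.
nra.
Qed.

(** The factors other than 1 - 2 |a|^4 are positive, so the sign of Phi_4 is read off from |a|^4,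
    which increases with e. *)
Lemma Phi4E e : 0 < e < pi / 3 -> Phi 4 e * absa e ^+ 2 =
  sin e * (1 - absa e ^+ 2) * (1 - 2 * absa e ^+ 4).
Proof.
move=> he; have r0 := absa_neq0 he; rewrite /Phi.
have -> : (4%:R - 2) * e = 2 * e by ring.
have -> : (4%:R - 1) * e = 2 * e + e by ring.
have s2 := sin2_etaE he.
have s3 : sin (2 * e + e) = sin (2 * e) / absa e - sin e.
  apply: (mulIf r0); rewrite mulrBl divfK //.
  rewrite (sin_rec he (2 * e)) (_ : 2 * e - e = e); last by ring.
  by ring.
by rewrite s3 s2; field.
Qed.

(* Up to the positive factor |a|^m, this function is the part of Phi_m that
   drives it negative, see [Phi_decomp] with m = n + 3. *)
Lemma Phi_aux_incr n e1 e2 : (2 <= n)%N ->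
  pi < n.+3%:R * e1 -> e1 < e2 -> (n.+3%:R - 1) * e2 < pi ->
  - (2 * cos e1) ^+ n * sin (n.+3%:R * e1) - sin e1
  < - (2 * cos e2) ^+ n * sin (n.+3%:R * e2) - sin e2.
Proof.
move=> n2 h1 h12 h2; set M := n.+3%:R : R.
have pi0 := pi_gt0 R.
have M5 : 5 <= M by rewrite /M (ler_nat R 5).
pose G x : R := - (2 * cos x) ^+ n * sin (M * x) - sin x.
pose dG x : R := n%:R * (2 * cos x) ^+ n.-1 * (2 * sin x) * sin (M * x)
   - (2 * cos x) ^+ n * (M * cos (M * x)) - cos x.
have isG x : is_derive x 1 G (dG x).
  have -> : G = (- ((2 : R) \*: @cos R) ^+ n) * (@sin R \o (M \*: id)) - @sin R.
    by apply/funext => y; rewrite /G /= !fctE.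
  apply: is_derive_eq.
  by rewrite /dG /GRing.scale /= !fctE /GRing.scale /=; ring.
have cG : {within `[e1, e2], continuous G}.
  apply: continuous_subspaceT => x.
  apply: differentiable_continuous; apply/derivable1_diffP.
  by have [d _] := isG x; exact: d.
have dG1 x : x \in `]e1, e2[ -> derivable G x 1.
  by move=> _; have [d _] := isG x; exact: d.
suff dG2 x : x \in `]e1, e2[ -> 0 < derive1 G x.
  exact: (gtr0_derive1_incr dG1 dG2 cG).
rewrite in_itv /= => /andP[x1 x2].
rewrite derive1E; have [_ ->] := isG x.
have xb : 0 < x <= pi / 4 by nra.
(* M x exceeds pi by d < x, so its sine and cosine are those of d with opposite sign. *)
have db : 0 < M * x - pi < x by nra.
have sE : sin (M * x) = - sin (M * x - pi) by rewrite sinB sinpi cospi; ring.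
have cE : cos (M * x) = - cos (M * x - pi) by rewrite cosB sinpi cospi; ring.
rewrite /dG sE cE; set d := M * x - pi in db *.
have s0 : 0 < sin d by apply: sin_gt0_pi; lra.
have sx : sin d <= sin x by apply: ler_sin_pihalf; lra.
have cx : cos x < cos d by apply: ltr_cos_0pi; lra.
have c2 : 1 / 2 <= cos x ^+ 2.
  have : 0 <= cos (x *+ 2) by apply: cos_ge0_pihalf; lra.
  by rewrite cos_mulr2n; lra.
have c1 : cos x <= 1 := cos_le1 x.
have cp : 0 < cos x by apply: cos_gt0_pihalf; lra.
have ss : sin x ^+ 2 <= cos x ^+ 2 by rewrite sin2cos2; lra.
have P1 : 1 <= (2 * cos x) ^+ n.-1 by apply: exprn_ege1; nra.
have -> : (2 * cos x) ^+ n = (2 * cos x) ^+ n.-1 * (2 * cos x).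
  by rewrite -exprSr prednK // (leq_trans _ n2).
(* With M = n + 3 the derivative is P times the bracket of [k3], minus cos x; since P >= 1, the
   lower bound 3 beats cos x <= 1. *)
have ME : M = n%:R + 3 by rewrite /M -addn3 natrD.
rewrite ME; set P := (2 * cos x) ^+ n.-1 in P1 *; set N := n%:R : R.
have N0 : 0 <= N by rewrite ler0n.
have k1 : 0 <= cos x * cos d - sin x * sin d by nra.
have k2 : 1 / 2 <= cos x * cos d by nra.
have k3 : 3 <= 2 * N * (cos x * cos d - sin x * sin d) + 6 * (cos x * cos d).
  by have := mulr_ge0 N0 k1; lra.
have : 3 <= P * (2 * N * (cos x * cos d - sin x * sin d) + 6 * (cos x * cos d)).
  by nra.
lra.
Qed.

(** With m = n + 3, the recurrence at (m - 1) e removes sin ((m - 2) e), and |a|^m (2 cos e)^n =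
    |a|^3 gives the form of [Phi_aux_incr]. *)
Lemma Phi_decomp n e : 0 < e < pi / 3 -> Phi n.+3 e =
  (1 - absa e ^+ 2 - absa e ^+ 4) * sin ((n.+3%:R - 1) * e)
  - absa e ^+ n.+3 * (- (2 * cos e) ^+ n * sin (n.+3%:R * e) - sin e).
Proof.
move=> he; rewrite /Phi; set M := n.+3%:R : R; set r := absa e.
have := sin_rec he ((M - 1) * e); rewrite -/r.
have -> : (M - 1) * e + e = M * e by ring.
have -> : (M - 1) * e - e = (M - 2) * e by ring.
move=> e1.
have e2 : r ^+ n.+3 * (2 * cos e) ^+ n = r ^+ 3.
  rewrite -addn3 exprD mulrAC -exprMn (_ : r * (2 * cos e) = 2 * r * cos e); last by ring.
  by rewrite cos_etaE // expr1n mul1r.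
rewrite (_ : r ^+ n.+3 * (_ - _) = - (r ^+ n.+3 * (2 * cos e) ^+ n) * sin (M * e) - r ^+ n.+3 * sin e);
  last by ring.
rewrite e2.
set S2 := sin ((M - 2) * e) in e1 *; set S1 := sin ((M - 1) * e) in e1 *.
have -> : r ^+ 3 * S2 = r ^+ 2 * (S1 - r * sin (M * e)) by rewrite e1; ring.
ring.
Qed.

(** For m = 4 this is the monotonicity of |a|. For m >= 5, from e1 to e2 the positive term of
    [Phi_decomp] decreases while the subtracted one increases. *)
Lemma Phi_neg_propagates m e1 e2 : (4 <= m)%N ->
  pi / m%:R < e1 -> e1 < e2 -> e2 < pi / (m%:R - 1) ->
  Phi m e1 <= 0 -> Phi m e2 < 0.
Proof.
move=> m4 h1 h12 h2; have pi0 := pi_gt0 R.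
have m0 : 4 <= m%:R :> R by rewrite (ler_nat R 4).
have e10 : 0 < e1 by apply: lt_trans h1; rewrite divr_gt0 //; lra.
have h1' : pi < m%:R * e1 by move: h1; rewrite ltr_pdivrMr; lra.
have h2' : (m%:R - 1) * e2 < pi by move: h2; rewrite ltr_pdivlMr; lra.
have e23 : e2 < pi / 3 by nra.
have he1 : 0 < e1 < pi / 3 by lra.
have he2 : 0 < e2 < pi / 3 by lra.
have r12 := absa_lt e10 h12 e23.
have r10 := absa_gt0 he1; have r20 := absa_gt0 he2; have r21 := absa_lt1 he2.
have s1 := sin_eta_gt0 he1; have s2 := sin_eta_gt0 he2.
have q2 : absa e1 ^+ 2 < absa e2 ^+ 2 by nra.
have q4 : absa e1 ^+ 4 < absa e2 ^+ 4.
  by rewrite !(exprM _ 2 2); apply: ltrXn2r => //; rewrite ?exprn_ge0 // ltW.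
move: m4; rewrite leq_eqVlt => /orP[/eqP m4|m5].
  rewrite -m4 => P1.
  have p1 := Phi4E he1; have p2 := Phi4E he2.
  have a1 : 0 < absa e1 ^+ 2 by rewrite exprn_gt0.
  have a2 : 0 < absa e2 ^+ 2 by rewrite exprn_gt0.
  have b1 : 0 < sin e1 * (1 - absa e1 ^+ 2) by apply: mulr_gt0 => //; nra.
  have b2 : 0 < sin e2 * (1 - absa e2 ^+ 2) by apply: mulr_gt0 => //; nra.
  have c1 : 1 - 2 * absa e1 ^+ 4 <= 0.
    by rewrite -(pmulr_rle0 _ b1) -p1 pmulr_lle0.
  by rewrite -(pmulr_llt0 _ a2) p2 pmulr_rlt0 //; lra.
case: m m5 m0 h1 h2 h1' h2' => [//|[//|[//|n]]] n2 m0 h1 h2 h1' h2'.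
rewrite !Phi_decomp //.
have M5 : 5 <= n.+3%:R :> R by rewrite (ler_nat R 5).
have G := Phi_aux_incr n2 h1' h12 h2'.
set M := n.+3%:R : R in M5 h1' h2' G *.
set G1 := _ - sin e1 in G *; set G2 := _ - sin e2 in G *.
have r2 : absa e2 ^+ 2 <= 1 / 2 by apply: absa_sqr_le => //; nra.
have Q2 : 0 < 1 - absa e2 ^+ 2 - absa e2 ^+ 4.
  rewrite (exprM _ 2 2); have : 0 <= absa e2 ^+ 2 by rewrite exprn_ge0 // ltW.
  by nra.
set Q := 1 - absa e2 ^+ 2 - _ in Q2 *.
set Q1 := 1 - absa e1 ^+ 2 - _.
have Q12 : Q < Q1 by rewrite /Q /Q1; lra.
have S21 : sin ((M - 1) * e2) <= sin ((M - 1) * e1) by apply: sin_le_obtuse; nra.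
have S2 : 0 < sin ((M - 1) * e2) by apply: sin_gt0_pi; nra.
have rr : absa e1 ^+ n.+3 <= absa e2 ^+ n.+3.
  by apply: lerXn2r; rewrite ?nnegrE ?ltW.
have rn : 0 < absa e1 ^+ n.+3 by rewrite exprn_gt0.
move: S21 S2 rr rn; set T2 := sin _; set T1 := sin _; set u := _ ^+ n.+3; set v := _ ^+ n.+3.
move=> S21 S2 rr rn H.
have QT : Q * T2 < Q1 * T1 by nra.
have G0 : 0 < G1.
  have : 0 < u * G1 by have := mulr_gt0 Q2 S2; lra.
  by rewrite pmulr_rgt0.
have : u * G1 < v * G2 by nra.
lra.
Qed.

(** As k e <= pi, eliminating sin ((k - 2) e) leaves nonnegative terms: (1 - |a|^2 - |a|^4) sin ((k
    - 1) e) + |a|^3 sin (k e) + |a|^k sin e. *)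
Lemma Phi_pos_small k e : (4 <= k)%N -> 0 < e < pi / 3 ->
  pi < (k%:R + 1) * e -> k%:R * e <= pi -> 0 < Phi k e.
Proof.
move=> k4 he h1 h2; have pi0 := pi_gt0 R; have /andP[e0 e3] := he.
have M4 : 4 <= k%:R :> R by rewrite (ler_nat R 4).
rewrite /Phi; set M := k%:R : R in M4 h1 h2 *.
have r0 := absa_gt0 he; have r1 := absa_lt1 he; have s0 := sin_eta_gt0 he.
have r2 : absa e ^+ 2 <= 1 / 2 by apply: absa_sqr_le => //; nra.
have := sin_rec he ((M - 1) * e).
have -> : (M - 1) * e + e = M * e by ring.
have -> : (M - 1) * e - e = (M - 2) * e by ring.
have : 0 <= sin (M * e) by apply: sin_ge0_pi; nra.
have : 0 < sin ((M - 1) * e) by apply: sin_gt0_pi; nra.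
set S0 := sin (M * e); set S1 := sin _; set S2 := sin _ => S1p S0p E.
have : 0 < absa e ^+ k * sin e by rewrite mulr_gt0 // exprn_gt0.
have -> : absa e ^+ 3 * S2 = absa e ^+ 2 * (S1 - absa e * S0) by rewrite E; ring.
have q0 : 0 <= absa e ^+ 2 by rewrite exprn_ge0 // ltW.
have q4 : absa e ^+ 4 <= 1 / 4 by rewrite (exprM _ 2 2); nra.
have : 0 <= absa e ^+ 2 * (absa e * S0) by apply: mulr_ge0 => //; apply: mulr_ge0 => //; exact: ltW.
nra.
Qed.

(** With d = k e - pi in [0, e), the value is |a|^(k+1) sin e - (1 - |a|^4) sin d - |a|^3 sin (e -
    d); use sin e <= sin d + sin (e - d) and |a|^(k+1) <= |a|^5. *)
Lemma Phi_neg_large k e : (4 <= k)%N -> 0 < e < pi / 3 -> absa e ^+ 4 <= 1 / 2 ->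
  pi <= k%:R * e -> (k%:R - 1) * e < pi -> Phi k.+1 e <= 0.
Proof.
move=> k4 he r4 h1 h2; have pi0 := pi_gt0 R; have /andP[e0 e3] := he.
have M4 : 4 <= k%:R :> R by rewrite (ler_nat R 4).
rewrite /Phi -natr1; set M := k%:R : R in M4 h1 h2 *.
have r0 := absa_gt0 he; have r1 := absa_lt1 he; have s0 := sin_eta_gt0 he.
have -> : (M + 1 - 1) * e = (M * e - pi) + pi by ring.
have -> : (M + 1 - 2) * e = pi - (e - (M * e - pi)) by ring.
rewrite sinDpi sinB sinpi cospi; set d := M * e - pi.
have d0 : 0 <= d < e by rewrite /d; nra.
have sd : 0 <= sin d by apply: sin_ge0_pi; lra.
have sed : 0 <= sin (e - d) by apply: sin_ge0_pi; lra.
have sub : sin e <= sin d + sin (e - d).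
  have -> : sin e = sin d * cos (e - d) + cos d * sin (e - d).
    by rewrite -sinD; congr sin; ring.
  by have := cos_le1 d; have := cos_le1 (e - d); nra.
have r5 : absa e ^+ k.+1 <= absa e ^+ 5.
  by apply: ler_wiXn2l; rewrite ?ltW //.
have r53 : absa e ^+ 5 <= absa e ^+ 3.
  by apply: ler_wiXn2l; rewrite ?ltW //.
have r50 : 0 <= absa e ^+ 5 by rewrite exprn_ge0 // ltW.
have r54 : absa e ^+ 5 <= 1 - absa e ^+ 4.
  have : absa e ^+ 5 <= absa e ^+ 4 by apply: ler_wiXn2l; rewrite ?ltW //.
  lra.
have e1 : absa e ^+ k.+1 * sin e <= absa e ^+ 5 * (sin d + sin (e - d)) by nra.
have e2 : absa e ^+ 5 * sin d <= (1 - absa e ^+ 4) * sin d by apply: ler_wpM2r.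
have e4 : absa e ^+ 5 * sin (e - d) <= absa e ^+ 3 * sin (e - d) by apply: ler_wpM2r.
lra.
Qed.

(** Each sign of Phi is direct on one side of pi/k. On the other, [Phi_neg_propagates] applies: from
    e to the zero e0 for Phi_k, by contradiction, and from the zero e1 to e for Phi_{k+1}. *)
Lemma Phi_signs k e e1 e0 : (4 <= k)%N ->
  pi / k.+1%:R < e1 < pi / k%:R -> Phi k.+1 e1 = 0 ->
  pi / k%:R < e0 < pi / (k%:R - 1) -> Phi k e0 = 0 ->
  e1 <= e < e0 ->
  [/\ pi < (k%:R + 1) * e, (k%:R - 1) * e < pi,
      absa e ^+ 4 < 1 / 2, 0 < Phi k e & Phi k.+1 e <= 0].
Proof.
move=> k4 /andP[a1 a2] P1 /andP[b1 b2] P0 /andP[ee1 ee0]; have pi0 := pi_gt0 R.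
have M4 : 4 <= k%:R :> R by rewrite (ler_nat R 4).
have e10 : 0 < e1 by apply: lt_trans a1; rewrite divr_gt0.
have H1 : pi < (k%:R + 1) * e.
  by move: a1; rewrite -natr1 ltr_pdivrMr; nra.
have H0 : (k%:R - 1) * e < pi.
  by move: b2; rewrite ltr_pdivlMr; nra.
have he : 0 < e < pi / 3 by apply/andP; split; nra.
have K0 : 0 < k%:R :> R by lra.
have Ppos : 0 < Phi k e.
  have [h|h] := leP (k%:R * e) pi; first exact: Phi_pos_small.
  rewrite ltNge; apply/negP => le0.
  have := @Phi_neg_propagates k e e0 k4 _ ee0 b2 le0; rewrite P0 ltxx => h'.
  by have : false by apply: h'; rewrite ltr_pdivrMr // mulrC.
have r4 : absa e ^+ 4 < 1 / 2.
  have r0 := absa_gt0 he; have r1 := absa_lt1 he; have s0 := sin_eta_gt0 he.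
  move: k4; rewrite leq_eqVlt => /orP[/eqP k4|k5].
    have q0 : 0 < absa e ^+ 2 by rewrite exprn_gt0.
    have : 0 < Phi 4 e * absa e ^+ 2 by rewrite mulr_gt0 // k4.
    rewrite Phi4E // pmulr_rgt0; first by lra.
    by apply: mulr_gt0 => //; nra.
  have M5 : 5 <= k%:R :> R by rewrite (ler_nat R 5).
  have : absa e ^+ 2 <= 1 / 2 by apply: absa_sqr_le => //; nra.
  have : 0 <= absa e ^+ 2 by rewrite exprn_ge0 // ltW.
  by rewrite (exprM _ 2 2); nra.
split => //.
have [h|h] := leP pi (k%:R * e); first by apply: Phi_neg_large => //; exact: ltW.
move: ee1; rewrite le_eqVlt => /orP[/eqP <-|ee1]; first by rewrite P1.
have hu : e < pi / (k.+1%:R - 1) by rewrite -natr1 addrK ltr_pdivlMr // mulrC.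
apply: ltW; apply: (Phi_neg_propagates (leqW k4) a1 ee1 hu).
by rewrite P1.
Qed.

End Phi_sign.

(** * Points and edges attached to eta *)

Section Points.
Context {R : realType}.
Implicit Types (t e : R) (x y z : R * R).

(** Identities between points are proved on heights, where [f1] and [f2] act by shifting the
    angle. *)
Lemma height_ext x y : (forall t, height t x = height t y) -> x = y.
Proof.
move=> h; have := h (pi / 2); have := h 0; rewrite /height cos0 sin0 cos_pihalf sin_pihalf.
by case: x y {h} => [x1 x2] [y1 y2] /= h2 h1; congr (_, _); lra.
Qed.

Lemma sinBpi t : sin (t - pi) = - sin t.
Proof. by rewrite sinB sinpi cospi; ring. Qed.

Lemma heightDpi t z : height (t + pi) z = - height t z.
Proof. by rewrite /height sinDpi cosDpi; ring. Qed.

Lemma height_csub t x y : height t (csub x y) = height t x - height t y.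
Proof. by rewrite /height /csub /=; ring. Qed.

Lemma cpow_a e j : cpow (a_of e) j = polar (absa e ^+ j) (j%:R * e).
Proof.
elim: j => [|j IH] /=; first by rewrite /polar mul0r cos0 sin0; congr (_, _); ring.
rewrite IH -natr1 mulrDl mul1r addrC /polar /cmul /a_of cosD sinD exprS /=.
by congr (_, _); ring.
Qed.

Lemma height_f1 e t z : height t (f1 e z) = absa e * height (t - e) z.
Proof. by rewrite /height /f1 /cmul /a_of /= sinB cosB; ring. Qed.

Lemma height_f2 e t z : height t (f2 e z) = sin t - absa e * height (t + e) z.
Proof. by rewrite /height /f2 /cmul /csub /creal /cconj /a_of /= sinD cosD; ring. Qed.

Lemma height_zj e t j :
  height t (zj e j) = c_of e * absa e ^+ j.+1 * sin (t - j.+1%:R * e).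
Proof.
rewrite /zj cpow_a (_ : cmul _ _ = polar (c_of e * absa e ^+ j.+1) (j.+1%:R * e)).
  by rewrite height_polar.
by rewrite /cmul /polar /=; congr (_, _); ring.
Qed.

Lemma height_wj e t j :
  height t (wj e j) = sin t - c_of e * absa e ^+ j.+2 * sin (t - j%:R * e).
Proof.
rewrite /wj height_csub cpow_a.
rewrite (_ : cmul _ _ = polar (c_of e * absa e ^+ j.+2) (j%:R * e)).
  by rewrite height_polar; congr (_ - _); rewrite /height /creal /=; ring.
by rewrite /cmul /polar /= !exprS; congr (_, _); ring.
Qed.

Lemma height_b0 e t :
  height t (bj e 0) = absa e * sin (t - e) + c_of e * absa e ^+ 4 * sin t.
Proof. by rewrite /height /bj /cadd /cmul /creal /a_of /= sinB; ring. Qed.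

Lemma f1_zj e j : f1 e (zj e j) = zj e j.+1.
Proof.
apply: height_ext => t; rewrite height_f1 !height_zj.
rewrite (_ : t - e - j.+1%:R * e = t - j.+2%:R * e); last by rewrite -!natr1; ring.
by rewrite [in RHS]exprS; ring.
Qed.

Lemma f2_zj e j : f2 e (zj e j) = wj e j.
Proof.
apply: height_ext => t; rewrite height_f2 height_zj height_wj.
rewrite (_ : t + e - j.+1%:R * e = t - j%:R * e); last by rewrite -!natr1; ring.
by rewrite [in RHS]exprS; ring.
Qed.

Lemma height_f2_wj e t j : height t (f2 e (wj e j)) =
  sin t - absa e * sin (t + e) + c_of e * absa e ^+ j.+3 * sin (t + e - j%:R * e).
Proof. by rewrite height_f2 height_wj [in RHS]exprS; ring. Qed.

(** As a - 1 is minus the conjugate of a, f1 w_j is w_{j+1} translated by a vector independent of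
    j. *)
Lemma height_f1_wj e t j : 0 < e < pi / 3 ->
  height t (f1 e (wj e j)) = height t (wj e j.+1) - absa e * sin (t + e).
Proof.
move=> he; rewrite height_f1 !height_wj (sin_rec he t).
rewrite (_ : t - e - j%:R * e = t - j.+1%:R * e); last by rewrite -!natr1; ring.
by rewrite [absa e ^+ j.+3]exprS; ring.
Qed.

Lemma f2_w1 e : 0 < e < pi / 3 -> f2 e (wj e 1) = bj e 0.
Proof.
move=> he; apply: height_ext => t; rewrite height_f2_wj height_b0 {1}(sin_rec he t).
rewrite (_ : t + e - 1%:R * e = t); last by ring.
by ring.
Qed.

Section Polygon_eta.
Variables (e : R) (he : 0 < e < pi / 3).
Local Notation r := (absa e).
Local Notation c := (c_of e).

Lemma absaX4_lt1 : 0 < 1 - r ^+ 4.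
Proof.
have := absa_lt1 he; have := absa_gt0 he => r0 r1.
by rewrite subr_gt0 exprn_ilt1 // ltW.
Qed.

Lemma c_ofE : c * (1 - r ^+ 4) = 1.
Proof. by rewrite /c_of div1r mulVf // gt_eqF // absaX4_lt1. Qed.

Lemma c_of_gt0 : 0 < c.
Proof. by rewrite /c_of div1r invr_gt0 absaX4_lt1. Qed.

Lemma edge_b0z0 : zj e 0 = cadd (bj e 0) (polar (c * r ^+ 5) (pi - e)).
Proof.
apply: height_ext => t; rewrite heightD height_polar height_zj height_b0.
rewrite (_ : t - (pi - e) = t + e - pi); last by ring.
rewrite sinBpi (sin_rec he t) mul1r expr1.
have E : r * sin (t - e) = c * (1 - r ^+ 4) * (r * sin (t - e)) by rewrite c_ofE mul1r.
by rewrite [X in X + _ + _]E; ring.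
Qed.

(** Since a - 1 is minus the conjugate of a, z_{j+1} - z_j = - c |a|^2 a^j. *)
Lemma edge_z j : zj e j.+1 = cadd (zj e j) (polar (c * r ^+ j.+2) (pi + j%:R * e)).
Proof.
apply: height_ext => t; rewrite heightD height_polar !height_zj.
rewrite (_ : t - (pi + j%:R * e) = t - j%:R * e - pi); last by ring.
rewrite sinBpi (sin_rec he (t - j.+1%:R * e)).
rewrite (_ : t - j.+1%:R * e + e = t - j%:R * e); last by rewrite -!natr1; ring.
rewrite (_ : t - j.+1%:R * e - e = t - j.+2%:R * e); last by rewrite -!natr1; ring.
by rewrite [r ^+ j.+2]exprS; ring.
Qed.

Lemma edge_w i : wj e i.+2 =
  cadd (wj e i.+1) (polar (c * r ^+ i.+4) (pi *+ 2 + i%:R * e)).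
Proof.
apply: height_ext => t; rewrite heightD height_polar !height_wj.
rewrite (_ : t - (pi *+ 2 + i%:R * e) = t - i%:R * e - pi - pi); last by ring.
rewrite !sinBpi (sin_rec he (t - i.+1%:R * e)).
rewrite (_ : t - i.+1%:R * e + e = t - i%:R * e); last by rewrite -!natr1; ring.
rewrite (_ : t - i.+1%:R * e - e = t - i.+2%:R * e); last by rewrite -!natr1; ring.
by rewrite [r ^+ i.+4]exprS; ring.
Qed.

(* f2 carries the edge from z_k to w_1 to the edge from w_k to b_0. *)
Lemma edge_wkb0 k rho A : wj e 1 = cadd (zj e k) (polar rho A) ->
  bj e 0 = cadd (wj e k) (polar (r * rho) (A + pi - e)).
Proof.
move=> E; apply: height_ext => t.
rewrite -f2_w1 // heightD height_polar -(f2_zj e k) !height_f2 E heightD height_polar.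
rewrite (_ : t - (A + pi - e) = t + e - A - pi); last by ring.
by rewrite sinBpi; ring.
Qed.

(** * The edge from z_k to w_1 *)

Variable k : nat.
Hypothesis k4 : (4 <= k)%N.
Local Notation M := (k%:R : R).
Hypothesis ke_lb : pi < (M + 1) * e.
Hypothesis ke_ub : (M - 1) * e < pi.
Hypothesis r4 : r ^+ 4 < 1 / 2.
Hypothesis Phi_k : 0 < Phi k e.
Hypothesis Phi_k1 : Phi k.+1 e <= 0.

Let M4 : 4 <= M. Proof. by rewrite (ler_nat R 4). Qed.

(* The height gap between w_1 and z_k, whose zero is the angle of the edge
   joining them. *)
Let gap t : R := height t (wj e 1) - height t (zj e k).

Let gapE t :
  gap t = sin t - c * r ^+ 3 * sin (t - e) - c * r ^+ k.+1 * sin (t - (M + 1) * e).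
Proof. by rewrite /gap height_wj height_zj natr1 mul1r. Qed.

(** This is the meaning of Phi_k: up to the factor -c, it is the height of w_1 over z_k at the angle
    of the edge from z_{k-1} to z_k. *)
Lemma gap_k : gap (pi + (M - 1) * e) = - (c * Phi k e).
Proof.
rewrite gapE /Phi.
rewrite (_ : pi + (M - 1) * e - e = (M - 2) * e + pi); last by ring.
rewrite (_ : pi + (M - 1) * e - (M + 1) * e = - (2 * e - pi)); last by ring.
rewrite (addrC pi) !sinDpi sinN sinBpi opprK sin2_etaE //.
rewrite !mulrDr (mulrA c (1 - r ^+ 4)) c_ofE (exprS _ k).
by field; exact: absa_neq0.
Qed.

Lemma gap_k1 : gap (pi + M * e) = - (c * Phi k.+1 e).
Proof.
rewrite gapE /Phi -(natr1 k).
rewrite (_ : pi + M * e - e = (M - 1) * e + pi); last by ring.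
rewrite (_ : pi + M * e - (M + 1) * e = - (e - pi)); last by ring.
rewrite (_ : (M + 1 - 1) * e = M * e); last by ring.
rewrite (_ : (M + 1 - 2) * e = (M - 1) * e); last by ring.
rewrite (addrC pi) !sinDpi sinN sinBpi opprK.
by rewrite !mulrDr (mulrA c (1 - r ^+ 4)) c_ofE; ring.
Qed.

(** Only k = 4 with 4 e > pi escapes this bound; the two gap lemmas below treat it exactly by
    [sin_multiples]. *)
Lemma eta_quarter : (5 <= k)%N \/ M * e <= pi -> e <= pi / 4.
Proof.
have := ke_ub; have := he; have h4 := M4 => /andP[e0 _] ub [k5|h].
  have M5 : 5 <= M by rewrite (ler_nat R 5).
  by nra.
by nra.
Qed.

Lemma sin_multiples : [/\ sin (5 * e) * r ^+ 4 = sin e * (1 - 3 * r ^+ 2 + r ^+ 4)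
  & sin (6 * e) * r ^+ 5 = sin e * (1 - 4 * r ^+ 2 + 3 * r ^+ 4)].
Proof.
have r0 := absa_neq0 he.
have rec n : sin ((n + 1) * e) = sin (n * e) / r - sin ((n - 1) * e).
  apply: (mulIf r0); rewrite mulrBl divfK // (sin_rec he (n * e)).
  rewrite (_ : n * e + e = (n + 1) * e); last by ring.
  rewrite (_ : n * e - e = (n - 1) * e); last by ring.
  by ring.
have s2 := sin2_etaE he.
have s3 : sin (3 * e) = sin e / r ^+ 2 - sin e.
  have := rec 2; rewrite (_ : 2 + 1 = 3); last by ring.
  rewrite (_ : 2 - 1 = 1); last by ring.
  by rewrite s2 mul1r => ->; field.
have s4 : sin (4 * e) = sin (3 * e) / r - sin (2 * e).
  have := rec 3; rewrite (_ : 3 + 1 = 4); last by ring.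
  by rewrite (_ : 3 - 1 = 2); last by ring.
have s5 : sin (5 * e) = sin (4 * e) / r - sin (3 * e).
  have := rec 4; rewrite (_ : 4 + 1 = 5); last by ring.
  by rewrite (_ : 4 - 1 = 3); last by ring.
have s6 : sin (6 * e) = sin (5 * e) / r - sin (4 * e).
  have := rec 5; rewrite (_ : 5 + 1 = 6); last by ring.
  by rewrite (_ : 5 - 1 = 4); last by ring.
by split; rewrite ?s6 s5 s4 s3 s2; field.
Qed.

(** Gives 2 pi - e <= A. For e <= pi/4 the left side of [h] is nonpositive, as (k + 2) e lies in
    [pi, 2 pi]. *)
Lemma gap_2piBe : gap (- e) <= 0.
Proof.
have pi0 := pi_gt0 R; have m4 := M4; have hl := ke_lb; have hu := ke_ub.
have s0 := sin_eta_gt0 he; have r0 := absa_gt0 he.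
have he' := he; have c0 := c_of_gt0.
rewrite gapE (_ : - e - e = - (2 * e)); last by ring.
rewrite (_ : - e - (M + 1) * e = - ((M + 2) * e)); last by ring.
rewrite !sinN sin2_etaE //.
suff h : r ^+ k.+1 * sin ((M + 2) * e) <= sin e * (1 - r ^+ 2 - r ^+ 4).
  have E : sin e * (1 - r ^+ 4) * c = sin e by rewrite -mulrA (mulrC _ c) c_ofE mulr1.
  have -> : - sin e - c * r ^+ 3 * - (sin e / r) - c * r ^+ k.+1 * - sin ((M + 2) * e)
     = c * (r ^+ k.+1 * sin ((M + 2) * e) - sin e * (1 - r ^+ 2 - r ^+ 4)).
    rewrite -[X in - X - _ - _]E; field; exact: absa_neq0.
  by rewrite pmulr_rle0 // subr_le0.
have [h4|h4] := leP e (pi / 4).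
  have [r2 q4] := absaX_le he h4.
  apply: (@le_trans _ _ 0); last by apply: mulr_ge0; lra.
  rewrite pmulr_rle0 ?exprn_gt0 //.
  rewrite -[(M + 2) * e](subrK (pi *+ 2)) sinD2pi.
  by apply: sin_le0_Npi; nra.
have kE : k = 4%N.
  have := k4; rewrite leq_eqVlt => /orP[/eqP //|k5].
  have q : e <= pi / 4 by apply: eta_quarter; left.
  by move: h4; rewrite ltNge q.
rewrite kE (_ : 4%:R + 2 = 6); last by ring.
have [_ s6] := sin_multiples; rewrite mulrC s6 ler_pM2l //.
have q0 : 0 <= r ^+ 2 by rewrite exprn_ge0 // ltW.
(* After division by sin e the claim is 4 |a|^4 <= 3 |a|^2. *)
have : r ^+ 2 <= 3 / 4 by move: r4; rewrite (exprM _ 2 2); nra.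
by rewrite (exprM _ 2 2); nra.
Qed.

(** Gives A < 2 pi. For e <= pi/4 one has - sin ((k + 1) e) <= sin (2 e) = sin e / |a|, so the
    second term of [h] is at least - |a|^k sin e. *)
Lemma gap_2pi : 0 < gap 0.
Proof.
have pi0 := pi_gt0 R; have m4 := M4; have hl := ke_lb; have hu := ke_ub.
have s0 := sin_eta_gt0 he; have r0 := absa_gt0 he; have r1 := absa_lt1 he.
have he' := he; have c0 := c_of_gt0.
rewrite gapE sin0 !sub0r !sinN.
suff h : 0 < r ^+ 3 * sin e + r ^+ k.+1 * sin ((M + 1) * e).
  by have := mulr_gt0 c0 h; lra.
have [h4|h4] := leP e (pi / 4).
  rewrite -[(M + 1) * e](subrK pi) sinDpi.
  have : sin ((M + 1) * e - pi) <= sin (2 * e).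
    by apply: ler_sin_pihalf; nra.
  rewrite sin2_etaE // => h.
  have rk : 0 < r ^+ k.+1 by rewrite exprn_gt0.
  have h' : r ^+ k.+1 * sin ((M + 1) * e - pi) <= r ^+ k * sin e.
    apply: (le_trans (ler_wpM2l (ltW rk) h)); rewrite exprS.
    by rewrite (_ : r * r ^+ k * (sin e / r) = r ^+ k * sin e) //; field; exact: absa_neq0.
  have : r ^+ k < r ^+ 3 by rewrite ltr_iXn2l.
  by nra.
have kE : k = 4%N.
  have := k4; rewrite leq_eqVlt => /orP[/eqP //|k5].
  have q : e <= pi / 4 by apply: eta_quarter; left.
  by move: h4; rewrite ltNge q.
rewrite kE (_ : 4%:R + 1 = 5); last by ring.
have [s5 _] := sin_multiples.
rewrite (_ : r ^+ 5 * sin (5 * e) = r * (sin (5 * e) * r ^+ 4)); last by ring.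
rewrite s5 (_ : _ + _ = r * sin e * (1 - r ^+ 2) ^+ 2); last by ring.
apply: mulr_gt0; [exact: mulr_gt0|apply: exprn_gt0].
by rewrite subr_gt0 exprn_ilt1 // ltW.
Qed.

Lemma edge_angle : exists A rho,
  [/\ pi + (M - 1) * e < A < pi *+ 2, pi *+ 2 - e <= A <= pi + M * e, 0 < rho
    & wj e 1 = cadd (zj e k) (polar rho A)].
Proof.
have pi0 := pi_gt0 R; have m4 := M4; have hl := ke_lb; have hu := ke_ub.
have he' := he; have c0 := c_of_gt0.
(* The maximum and the minimum let a single zero of [gap], from the intermediate value theorem, meet
   all four bounds on A. *)
pose t1 := Num.max (pi + (M - 1) * e) (pi *+ 2 - e).
pose t2 := Num.min (pi + M * e) (pi *+ 2).
have g1 : gap (pi + (M - 1) * e) < 0 by rewrite gap_k oppr_lt0 mulr_gt0.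
have gper t : gap (t + pi *+ 2) = gap t by rewrite /gap !heightD2pi.
have g2 : gap (pi *+ 2 - e) <= 0 by rewrite addrC gper gap_2piBe.
have g3 : 0 <= gap (pi + M * e).
  by rewrite gap_k1 oppr_ge0 pmulr_rle0.
have g4 : 0 < gap (pi *+ 2) by rewrite -[pi *+ 2]add0r gper gap_2pi.
have t12 : t1 <= t2.
  rewrite /t1 /t2 ge_max !le_min; apply/andP; split; apply/andP; split; lra.
have gt1 : gap t1 <= 0 by rewrite /t1 /Num.max; case: ifP => _ //; exact: (ltW g1).
have gt2 : 0 <= gap t2 by rewrite /t2 /Num.min; case: ifP => _ //; exact: (ltW g4).
have gcont : {within `[t1, t2], continuous gap}.
  apply: continuous_subspaceT => t.
  pose d := csub (wj e 1) (zj e k).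
  have -> : gap = (fun s => sin s * d.1 + cos s * d.2).
    by apply/funext => s; rewrite /gap -height_csub.
  exact: (cvgD (cvgM (@continuous_sin R t) (cvg_cst _)) (cvgM (@continuous_cos R t) (cvg_cst _))).
have [A] : exists2 A, A \in `[t1, t2] & gap A = 0.
  apply: IVT => //; rewrite ge_min le_max gt1 gt2 orbT //.
rewrite in_itv /= /t1 /t2 ge_max le_min => /andP[/andP[a1 a2] /andP[a3 a4]] gA.
have a1' : pi + (M - 1) * e < A.
  rewrite lt_neqAle a1 andbT; apply/eqP => E.
  by move: g1; rewrite E gA ltxx.
have a4' : A < pi *+ 2.
  rewrite lt_neqAle a4 andbT; apply/eqP => E.
  by move: g4; rewrite -E gA ltxx.
pose d := csub (wj e 1) (zj e k).
have gd t : gap t = height t d by rewrite /gap -height_csub.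
(* As w_1 - z_k has height 0 at A, it is a multiple of the direction at A, and rho is the
   multiple. *)
pose rho := cos A * d.1 - sin A * d.2.
have dE : d = polar rho A.
  have h0 : sin A * d.1 + cos A * d.2 = 0 by have := gA; rewrite gd.
  have C := cos2Dsin2 A.
  rewrite /polar [LHS]surjective_pairing; congr (_, _).
    rewrite -[LHS]mul1r -C /rho.
    rewrite (_ : _ * d.1 = (cos A * d.1 - sin A * d.2) * cos A + sin A * (sin A * d.1 + cos A * d.2)).
      by rewrite h0; ring.
    by ring.
  rewrite -[LHS]mul1r -C /rho.
  rewrite (_ : _ * d.2 = - ((cos A * d.1 - sin A * d.2) * sin A) + cos A * (sin A * d.1 + cos A * d.2)).
    by rewrite h0; ring.
  by ring.
have rho0 : 0 < rho.
  move: g1; rewrite gd dE height_polar nmulr_llt0 //.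
  by apply: sin_lt0_Npi; lra.
exists A, rho; split => //; rewrite ?a1' ?a4' ?a2 ?a3 //.
rewrite -dE /d; case: (wj e 1) (zj e k) => [w1 w2] [z1 z2].
by rewrite /cadd /csub /=; congr (_, _); ring.
Qed.

End Polygon_eta.
End Points.

(** * The polygon and its invariance *)

(** The cases are b_0; z_0, ..., z_{k-1}; z_k; w_1, ..., w_{k-1}; w_k, grouped by the kind of edge
    leaving them. *)
Lemma vertex_index_ind (k : nat) (P : nat -> Prop) : (1 < k)%N ->
  P 0%N -> (forall j, (j < k)%N -> P j.+1) -> P k.+1 ->
  (forall i, (i.+1 < k)%N -> P (k.+2 + i)%N) -> P (k + k).+1 ->
  forall i, (i < (k + k).+2)%N -> P i.
Proof.
move=> k1 P0 Pz PA Pw PB [//|i] hi.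
have [/Pz//|] := ltnP i k; rewrite leq_eqVlt => /orP[/eqP<-//|ki].
have [hk|hk] := ltnP i (k + k).
  have -> : i.+1 = (k.+2 + (i - k.+1))%N by lia.
  by apply: Pw; lia.
by have -> : i.+1 = (k + k).+1 by lia.
Qed.

Section Vertices.
Context {R : realType}.
Variables (e : R) (k : nat).
Hypothesis k4 : (4 <= k)%N.
Local Notation ps := (vertex_list e k).
Local Notation p i := (nth (0, 0) ps i).
Local Notation M := (k%:R : R).

Lemma size_vertex_list : size ps = (k + k).+2.
Proof. by rewrite /vertex_list /= size_cat !size_map !size_iota. Qed.

Let nth_vertexS i : p i.+1 =
  nth (0, 0) ([seq zj e j | j <- iota 0 k.+1] ++ [seq wj e j | j <- iota 1 k]) i.
Proof. by []. Qed.

Lemma nth_vertex_z j : (j <= k)%N -> p j.+1 = zj e j.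
Proof.
move=> jk; rewrite nth_vertexS nth_cat size_map size_iota ltnS jk.
by rewrite (nth_map 0%N) ?size_iota // nth_iota.
Qed.

Lemma nth_vertex_w i : (i < k)%N -> p (k.+2 + i) = wj e i.+1.
Proof.
move=> ik; rewrite addSn nth_vertexS nth_cat size_map size_iota ltnNge leq_addr /=.
by rewrite addKn (nth_map 0%N) ?size_iota // nth_iota // add1n.
Qed.

Lemma nth_vertex_wlast : p (k + k).+1 = wj e k.
Proof.
have -> : (k + k).+1 = (k.+2 + k.-1)%N by lia.
by rewrite nth_vertex_w; [congr wj; lia|lia].
Qed.

Variables (A rho : R).

(** Entry i belongs to the edge leaving vertex i: position 0 is b_0, j + 1 is z_j and k + 2 + i is
    w_{i+1}. *)
Definition edge_al i : R :=
  if i is j.+1 then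
    if (j < k)%N then pi + j%:R * e
    else if j == k then A
    else if (j < k + k)%N then pi *+ 2 + (j - k.+1)%:R * e
    else A + pi - e
  else pi - e.

Definition edge_len i : R :=
  if i is j.+1 then
    if (j < k)%N then c_of e * absa e ^+ j.+2
    else if j == k then rho
    else if (j < k + k)%N then c_of e * absa e ^+ (j - k.+1).+4
    else absa e * rho
  else c_of e * absa e ^+ 5.

Lemma edge_al_z j : (j < k)%N -> edge_al j.+1 = pi + j%:R * e.
Proof. by move=> jk; rewrite /edge_al jk. Qed.

Lemma edge_al_A : edge_al k.+1 = A.
Proof. by rewrite /edge_al ltnn eqxx. Qed.

Lemma edge_al_w i : (i.+1 < k)%N -> edge_al (k.+2 + i) = pi *+ 2 + i%:R * e.
Proof.
move=> ik; rewrite /edge_al addSn.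
have -> : (k.+1 + i < k)%N = false by lia.
have -> : (k.+1 + i == k)%N = false by lia.
have -> : (k.+1 + i < k + k)%N by lia.
by have -> : (k.+1 + i - k.+1 = i)%N by lia.
Qed.

Lemma edge_al_B : edge_al (k + k).+1 = A + pi - e.
Proof.
rewrite /edge_al.
have -> : (k + k < k)%N = false by lia.
have -> : (k + k == k)%N = false by lia.
by rewrite ltnn.
Qed.

Lemma edge_len_w i : (i.+1 < k)%N -> edge_len (k.+2 + i) = c_of e * absa e ^+ i.+4.
Proof.
move=> ik; rewrite /edge_len addSn.
have -> : (k.+1 + i < k)%N = false by lia.
have -> : (k.+1 + i == k)%N = false by lia.
have -> : (k.+1 + i < k + k)%N by lia.
by have -> : (k.+1 + i - k.+1 = i)%N by lia.
Qed.

Lemma edge_len_B : edge_len (k + k).+1 = absa e * rho.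
Proof.
rewrite /edge_len.
have -> : (k + k < k)%N = false by lia.
have -> : (k + k == k)%N = false by lia.
by rewrite ltnn.
Qed.

Ltac idx := move: k4; repeat match goal with H : is_true (leq _ _) |- _ => move: H; clear H end; clear; lia.

Hypothesis he : 0 < e < pi / 3.
Hypothesis ke_lb : pi < (M + 1) * e.
Hypothesis ke_ub : (M - 1) * e < pi.
Hypothesis A_open : pi + (M - 1) * e < A < pi *+ 2.
Hypothesis A_closed : pi *+ 2 - e <= A <= pi + M * e.
Hypothesis rho_gt0 : 0 < rho.
Hypothesis edge_zkw1 : wj e 1 = cadd (zj e k) (polar rho A).

Let k_gt1 : (1 < k)%N. Proof. exact: leq_trans k4. Qed.
Let M4 : 4 <= M. Proof. by rewrite (ler_nat R 4). Qed.

Lemma vertex_size3 : (3 <= size ps)%N.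
Proof. by rewrite size_vertex_list; move: k4; clear; lia. Qed.

Lemma vertex_edge_len i : (i < size ps)%N -> 0 < edge_len i.
Proof.
have c0 := c_of_gt0 he; have r0 := absa_gt0 he.
have pos n : 0 < c_of e * absa e ^+ n by rewrite mulr_gt0 // exprn_gt0.
rewrite size_vertex_list; move: i; apply: vertex_index_ind => //.
- exact: pos.
- by move=> j jk; rewrite /= jk.
- by rewrite /= ltnn eqxx.
- by move=> i ik; rewrite edge_len_w.
- by rewrite edge_len_B mulr_gt0.
Qed.

Lemma vertex_edge i : (i < size ps)%N ->
  p (i.+1 %% size ps)%N = cadd (p i) (polar (edge_len i) (edge_al i)).
Proof.
rewrite size_vertex_list; move: i; apply: vertex_index_ind => //.
- by rewrite modn_small // nth_vertex_z //; exact: edge_b0z0.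
- move=> j jk; rewrite modn_small; last by move: jk; clear; lia.
  rewrite !nth_vertex_z // ?(ltnW jk) // edge_al_z //= jk.
  exact: edge_z.
- rewrite modn_small; last by move: k4; clear; lia.
  have -> : k.+2 = (k.+2 + 0)%N by rewrite addn0.
  rewrite nth_vertex_w; last exact: ltnW.
  by rewrite nth_vertex_z // edge_al_A /= ltnn eqxx.
- move=> i ik; rewrite modn_small; last by move: ik; clear; lia.
  rewrite -addnS !nth_vertex_w // ?(ltnW ik) // edge_al_w // edge_len_w //.
  exact: edge_w.
- by rewrite modnn nth_vertex_wlast edge_al_B edge_len_B; exact: edge_wkb0.
Qed.

(** The turn at z_k uses pi + (k - 1) e < A, the turn at w_1 uses A < 2 pi, and the turn at w_k the
    first bound again. *)
Lemma vertex_al_step i : (i.+1 < size ps)%N ->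
  edge_al i < edge_al i.+1 < edge_al i + pi.
Proof.
have pi0 := pi_gt0 R; have m4 := M4; have hl := ke_lb; have hu := ke_ub.
have he' := he; have /andP[a1 a2] := A_open; have /andP[a3 a4] := A_closed.
move=> hi; have : (i < (k + k).+2)%N by rewrite -size_vertex_list ltnW.
move: i hi; rewrite size_vertex_list => i hi hi2; move: i hi2 hi.
apply: vertex_index_ind => //.
- by move=> _; rewrite edge_al_z ?(ltnW k_gt1) //= mul0r; lra.
- move=> j jk _; rewrite edge_al_z //.
  move: jk; rewrite leq_eqVlt => /orP[/eqP jk|jk].
    have jE : j%:R = M - 1 by rewrite -jk -natr1 addrK.
    by rewrite jk edge_al_A jE; lra.
  by rewrite edge_al_z // -natr1; lra.
- move=> _; rewrite edge_al_A -[k.+2]addn0 edge_al_w // mul0r; lra.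
- move=> i; rewrite leq_eqVlt => /orP[/eqP ik _|ik _].
    have iE : i%:R = M - 2 by rewrite -ik -!natr1; ring.
    rewrite -addnS edge_al_w; last by rewrite -ik.
    have -> : (k.+2 + i.+1 = (k + k).+1)%N by move: ik; clear; lia.
    rewrite edge_al_B iE; lra.
  rewrite -addnS edge_al_w; last exact: ltnW.
  by rewrite edge_al_w // -natr1; lra.
- by rewrite ltnn.
Qed.

Lemma vertex_al_wrap :
  edge_al (size ps).-1 < edge_al 0 + pi *+ 2 < edge_al (size ps).-1 + pi.
Proof.
have pi0 := pi_gt0 R; have m4 := M4; have hu := ke_ub.
have he' := he; have /andP[a1 a2] := A_open.
have : 0 <= (M - 1) * e by apply: mulr_ge0; lra.
by rewrite size_vertex_list /= -/(edge_al (k + k).+1) edge_al_B; lra.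
Qed.

Local Notation HP := (halfplanes ps edge_al).

Lemma vertex_list_polygon : polygon_cw HP ps.
Proof.
apply: polygon_cw_halfplanes.
- exact: vertex_size3.
- exact: vertex_edge_len.
- exact: vertex_edge.
- exact: vertex_al_step.
- exact: vertex_al_wrap.
Qed.

Lemma HP_intro z :
  height (pi - e) z <= height (pi - e) (bj e 0) ->
  (forall j, (j < k)%N -> height (pi + j%:R * e) z <= height (pi + j%:R * e) (zj e j)) ->
  height A z <= height A (zj e k) ->
  (forall i, (i.+1 < k)%N -> height (i%:R * e) z <= height (i%:R * e) (wj e i.+1)) ->
  height (A + pi - e) z <= height (A + pi - e) (wj e k) ->
  HP z.
Proof.
move=> h0 hz hA hw hB i; rewrite size_vertex_list; move: i.
apply: vertex_index_ind => //.
- by move=> j jk; rewrite edge_al_z // nth_vertex_z ?(ltnW jk) //; exact: hz.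
- by rewrite edge_al_A nth_vertex_z.
- move=> i ik; rewrite edge_al_w // nth_vertex_w ?(ltnW ik) //.
  by rewrite addrC !heightD2pi; exact: hw.
- by rewrite edge_al_B nth_vertex_wlast.
Qed.

(** * Normal cones of the vertices *)

Lemma cone_step i t z : (i.+1 < size ps)%N -> edge_al i <= t <= edge_al i.+1 ->
  HP z -> height t z <= height t (p i.+1).
Proof.
exact: (halfplanes_cone vertex_edge vertex_al_step).
Qed.

Lemma cone_z j t z : (j < k)%N -> pi + (j%:R - 1) * e <= t <= pi + j%:R * e ->
  HP z -> height t z <= height t (zj e j).
Proof.
move=> jk ht hz; rewrite -(nth_vertex_z (ltnW jk)).
apply: cone_step => //; first by rewrite size_vertex_list; idx.
rewrite edge_al_z //; case: j jk ht => [|j] jk ht.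
  by rewrite /=; move: ht; lra.
by rewrite edge_al_z ?(ltnW jk) //; move: ht; rewrite -natr1; lra.
Qed.

Lemma cone_zk t z : pi + (M - 1) * e <= t <= A ->
  HP z -> height t z <= height t (zj e k).
Proof.
move=> ht hz; rewrite -(nth_vertex_z (leqnn k)).
apply: cone_step => //; first by rewrite size_vertex_list; idx.
rewrite edge_al_A -[k in edge_al k](ltn_predK k4) edge_al_z; last by idx.
have -> : k.-1%:R = M - 1 by rewrite -subn1 natrB // ltnW.
exact: ht.
Qed.

Lemma cone_w1 t z : A <= t <= pi *+ 2 -> HP z -> height t z <= height t (wj e 1).
Proof.
move=> ht hz; rewrite -(@nth_vertex_w 0); last by idx.
rewrite addn0; apply: cone_step => //; first by rewrite size_vertex_list; idx.
by rewrite edge_al_A -[k.+2]addn0 edge_al_w // mul0r addr0.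
Qed.

Lemma cone_w i t z : (i.+2 < k)%N -> pi *+ 2 + i%:R * e <= t <= pi *+ 2 + (i%:R + 1) * e ->
  HP z -> height t z <= height t (wj e i.+2).
Proof.
move=> ik ht hz; rewrite -(@nth_vertex_w i.+1); last by idx.
rewrite addnS; apply: cone_step => //; first by rewrite size_vertex_list; idx.
by rewrite -addnS !edge_al_w -?natr1 //; idx.
Qed.

Lemma cone_wk t z : pi *+ 2 + (M - 2) * e <= t <= A + pi - e ->
  HP z -> height t z <= height t (wj e k).
Proof.
move=> ht hz; rewrite -nth_vertex_wlast.
apply: cone_step => //; first by rewrite size_vertex_list; idx.
rewrite edge_al_B; have -> : (k + k)%N = (k.+2 + (k - 2))%N by idx.
rewrite edge_al_w; last by idx.
have -> : (k - 2)%:R = M - 2 by rewrite natrB.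
exact: ht.
Qed.

Lemma cone_b0 t z : A + pi - e <= t <= pi *+ 3 - e ->
  HP z -> height t z <= height t (bj e 0).
Proof.
move=> ht hz; apply: (halfplanes_cone_wrap vertex_size3 vertex_edge vertex_al_wrap) => //.
rewrite size_vertex_list /= -/(edge_al (k + k).+1) edge_al_B; move: ht; lra.
Qed.

Lemma HP_vertex i : (i < size ps)%N -> HP (p i).
Proof.
apply: vertex_halfplanes.
- exact: vertex_size3.
- exact: vertex_edge_len.
- exact: vertex_edge.
- exact: vertex_al_step.
- exact: vertex_al_wrap.
Qed.

Lemma HP_z j : (j <= k)%N -> HP (zj e j).
Proof.
move=> jk; rewrite -(nth_vertex_z jk).
by apply: HP_vertex; rewrite size_vertex_list; idx.
Qed.

Lemma HP_w i : (i < k)%N -> HP (wj e i.+1).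
Proof.
move=> jk; rewrite -(nth_vertex_w jk).
by apply: HP_vertex; rewrite size_vertex_list; idx.
Qed.


(** * Invariance of the polygon under [f1] and [f2] *)

Local Notation r := (absa e).
Local Notation c := (c_of e).

(** Reduces a bound on the image of the polygon to one vertex v, chosen with the shifted angle t - e
    in its normal cone. *)
Lemma height_f1_le t s v z (X : R) : s = t - e \/ s = t - e + pi *+ 2 ->
  height s z <= height s v -> height t (f1 e v) <= X -> height t (f1 e z) <= X.
Proof.
have r0 := absa_gt0 he.
by case=> ->; rewrite ?heightD2pi !height_f1 => h; apply: le_trans;
  rewrite ler_pM2l.
Qed.

Lemma height_f2_le t s v z (X : R) : s = t + e + pi \/ s + pi *+ 2 = t + e + pi ->
  height s z <= height s v -> height t (f2 e v) <= X -> height t (f2 e z) <= X.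
Proof.
have r0 := absa_gt0 he.
move=> hs; have hh x : height s x = - height (t + e) x.
  by case: hs => hs; rewrite -heightDpi -hs ?heightD2pi.
rewrite !hh lerN2 !height_f2 => h; apply: le_trans.
by rewrite lerB // ler_pM2l.
Qed.

Lemma height_z_edge j : height (pi + j%:R * e) (zj e j) = c * r ^+ j.+1 * sin e.
Proof.
rewrite height_zj (_ : pi + j%:R * e - j.+1%:R * e = - (e - pi)).
  by rewrite sinN sinBpi opprK.
by rewrite -natr1; ring.
Qed.

Lemma height_z_edge_next j :
  height (pi + j%:R * e) (zj e j.+1) = height (pi + j%:R * e) (zj e j).
Proof. by rewrite (edge_z he) heightD height_polar subrr sin0 mulr0 addr0. Qed.

Let crn_ge0 n : 0 <= c * r ^+ n.
Proof.
by apply: mulr_ge0; [exact/ltW/c_of_gt0|apply: exprn_ge0; exact/ltW/absa_gt0].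
Qed.

Let crs_ge0 n : 0 <= c * r ^+ n * sin e.
Proof. by apply: mulr_ge0 => //; exact/ltW/sin_eta_gt0. Qed.

Let eta_quarter_le : M * e <= pi -> e <= pi / 4.
Proof. by have := he; have := M4 => m4 /andP[e0 _] h; nra. Qed.

(** [f1] sends z_k to z_{k+1}, which is not listed; this keeps it below the edge from w_1. The
    reason is (k + 2) e - pi <= 2 e. *)
Lemma height_zk1_top : M * e <= pi -> height 0 (zj e k.+1) <= height 0 (wj e 1).
Proof.
move=> hM; have h4 := eta_quarter_le hM.
have pi0 := pi_gt0 R; have m4 := M4; have hl := ke_lb; have he' := he.
have s0 := sin_eta_gt0 he; have r0 := absa_gt0 he; have r1 := absa_lt1 he.
have c0 := c_of_gt0 he.
rewrite height_zj height_wj sin0 !sub0r mul1r !sinN -!natr1.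
rewrite (_ : (M + 1 + 1) * e = (M + 2) * e - pi + pi); last by ring.
rewrite sinDpi opprK mulrN opprK.
have h : sin ((M + 2) * e - pi) <= sin e / r.
  by rewrite -(sin2_etaE he); apply: ler_sin_pihalf; nra.
have rk : 0 < c * r ^+ k.+2 by rewrite mulr_gt0 // exprn_gt0.
apply: (le_trans (ler_wpM2l (ltW rk) h)).
rewrite exprS (_ : _ * (sin e / r) = c * r ^+ k.+1 * sin e); last first.
  by field; exact: absa_neq0.
rewrite ler_pM2r // ler_pM2l //.
by apply: ler_wiXn2l; rewrite ?ltW //.
Qed.

Lemma height_wk1_b0 : M * e <= pi ->
  height (pi - e) (wj e k.+1) <= height (pi - e) (bj e 0).
Proof.
move=> hM; rewrite -(f2_w1 he) -(f2_zj e k.+1) !height_f2.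
rewrite (_ : pi - e + e = 0 + pi); last by ring.
rewrite !heightDpi; have := height_zk1_top hM; have := absa_gt0 he; nra.
Qed.

(** The step from z_k to z_{k+1} has angle pi + k e >= A, so it does not raise the height at A. *)
Lemma height_zk1_A : height A (zj e k.+1) <= height A (zj e k).
Proof.
have := he; have := pi_gt0 R; have := M4; have := A_open; have := A_closed.
move=> a1 a2 m4 pi0 he'.
rewrite (edge_z he) heightD height_polar -[leRHS]addr0 lerD2l.
rewrite pmulr_rle0; last first.
  by rewrite mulr_gt0 ?exprn_gt0 ?absa_gt0 ?c_of_gt0.
by apply: sin_le0_Npi; nra.
Qed.

Lemma height_wk1_B : height (A + pi - e) (wj e k.+1) <= height (A + pi - e) (wj e k).
Proof.
rewrite -!f2_zj !height_f2 (_ : A + pi - e + e = A + pi); last by ring.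
rewrite !heightDpi; have := height_zk1_A; have := absa_gt0 he; nra.
Qed.

Lemma sin_k1_le : sin ((M - 1) * e) <= sin ((M - 2) * e).
Proof.
have pi0 := pi_gt0 R; have m4 := M4; have hl := ke_lb; have hu := ke_ub; have he' := he.
have e0 : 0 <= (M - 4) * e by apply: mulr_ge0; lra.
have [h|h] := leP ((M - 2) * e) (pi / 2).
  have -> : sin ((M - 1) * e) = sin (pi - (M - 1) * e) by rewrite sinB sinpi cospi; ring.
  by apply: ler_sin_pihalf; lra.
by apply: sin_le_obtuse; lra.
Qed.

(** With S_i = sin ((k - i) e) the left side is c |a|^5 S_1 - (1 - |a|^2) S_2, nonpositive since S_1
    <= S_2 and c |a|^5 <= 1 - |a|^2. *)
Lemma height_f2b0_le : M * e <= pi ->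
  height (pi + (M - 2) * e) (f2 e (bj e 0)) <= c * r ^+ k.-1 * sin e.
Proof.
move=> hM; have h4 := eta_quarter_le hM.
have pi0 := pi_gt0 R; have m4 := M4; have he' := he.
have s0 := sin_eta_gt0 he; have r0 := absa_gt0 he; have r1 := absa_lt1 he.
have c0 := c_of_gt0 he; have cE := c_ofE he.
have [r2 q4] := absaX_le he h4.
rewrite height_f2 height_b0.
rewrite (_ : pi + (M - 2) * e + e - e = (M - 2) * e + pi); last by ring.
rewrite (_ : pi + (M - 2) * e + e = (M - 1) * e + pi); last by ring.
rewrite (addrC pi) !sinDpi.
have S := sin_k1_le.
have S2 : 0 <= sin ((M - 2) * e) by apply: sin_ge0_pi; have := ke_ub; nra.
have : 0 <= c * r ^+ k.-1 * sin e := crs_ge0 _.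
have r5 : r ^+ 5 <= r ^+ 4 by apply: ler_wiXn2l; rewrite ?ltW //.
have cr5 : c * r ^+ 5 <= 1 - r ^+ 2.
  have h : r ^+ 5 <= (1 - r ^+ 2) * (1 - r ^+ 4) by nra.
  have -> : 1 - r ^+ 2 = c * ((1 - r ^+ 2) * (1 - r ^+ 4)) by rewrite mulrCA cE mulr1.
  by rewrite ler_pM2l.
have c5 : 0 <= c * r ^+ 5 := crn_ge0 _.
have h1 : c * r ^+ 5 * sin ((M - 1) * e) <= c * r ^+ 5 * sin ((M - 2) * e).
  exact: ler_wpM2l.
have h2 : c * r ^+ 5 * sin ((M - 2) * e) <= (1 - r ^+ 2) * sin ((M - 2) * e).
  exact: ler_wpM2r.
lra.
Qed.

(** w_0 = f2 z_0 is the real number 1 - c |a|^2; it is not listed and needs its own bounds. *)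
Lemma height_w0 t : height (pi + t) (wj e 0) = - ((1 - c * r ^+ 2) * sin t).
Proof. by rewrite height_wj mul0r subr0 (addrC pi) sinDpi; ring. Qed.

Let cr2_le1 : e <= pi / 4 -> 0 <= 1 - c * r ^+ 2.
Proof.
move=> h4; have [r2 q4] := absaX_le he h4; have c0 := c_of_gt0 he; have := c_ofE he; nra.
Qed.

Lemma height_w0_k : M * e <= pi ->
  height (pi + (M - 1) * e) (wj e 0) <= c * r ^+ k * sin e.
Proof.
move=> hM; have h4 := eta_quarter_le hM.
have pi0 := pi_gt0 R; have m4 := M4; have he' := he.
have s0 := sin_eta_gt0 he; have r0 := absa_gt0 he; have c0 := c_of_gt0 he.
rewrite height_w0; apply: (@le_trans _ _ 0); last exact: crs_ge0.
rewrite oppr_le0; apply: mulr_ge0; first exact: cr2_le1.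
by apply: sin_ge0_pi; have := ke_ub; nra.
Qed.

Lemma height_w0_k1 :
  height (pi + (M - 2) * e) (wj e 0) <= c * r ^+ k.-1 * sin e.
Proof.
have pi0 := pi_gt0 R; have m4 := M4; have he' := he.
have s0 := sin_eta_gt0 he; have r0 := absa_gt0 he; have c0 := c_of_gt0 he.
have r1 := absa_lt1 he.
have S2 : 0 <= sin ((M - 2) * e) by apply: sin_ge0_pi; have := ke_ub; nra.
rewrite height_w0; have [h4|h4] := leP e (pi / 4).
  apply: (@le_trans _ _ 0); last exact: crs_ge0.
  by rewrite oppr_le0; apply: mulr_ge0 => //; exact: cr2_le1.
have kE : k = 4%N.
  have := k4; rewrite leq_eqVlt => /orP[/eqP //|k5].
  have M5 : 5 <= M by rewrite (ler_nat R 5).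
  by exfalso; have := ke_ub; nra.
(* Both sides are multiples of sin e / |a|, and the claim becomes c |a|^2 <= 1 + c |a|^4 = c. *)
rewrite kE (_ : 4%:R - 2 = 2); last by ring.
rewrite sin2_etaE //=.
have E : c * r ^+ 3 * sin e = (c * r ^+ 4) * (sin e / r) by field; exact: absa_neq0.
have sr : 0 < sin e / r by exact: divr_gt0.
rewrite E -mulNr (ler_pM2r sr).
have := c_ofE he; have : r ^+ 2 <= 1 by rewrite exprn_ile1 // ltW.
nra.
Qed.

(** The recurrence and c (1 - |a|^4) = 1 reduce this to |a|^(j+1) sin e + |a| sin ((j - 1) e) >=
    0. *)
Lemma height_f2w_le j : (j.+2 < k)%N ->
  height (pi + j%:R * e) (f2 e (wj e j.+2)) <= height (pi + j%:R * e) (zj e j).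
Proof.
move=> jk; have pi0 := pi_gt0 R; have he' := he.
have s0 := sin_eta_gt0 he; have r0 := absa_gt0 he.
rewrite height_z_edge height_f2_wj.
rewrite (_ : pi + j%:R * e + e - j.+2%:R * e = - (e - pi)); last by rewrite -!natr1; ring.
rewrite (_ : pi + j%:R * e + e = (j%:R * e + e) + pi); last by ring.
rewrite (addrC pi) !sinDpi sinN sinBpi opprK (sin_rec he (j%:R * e)).
have E : c * r ^+ j.+1 * sin e = r ^+ j.+1 * sin e + c * r ^+ j.+1 * r ^+ 4 * sin e.
  have -> : r ^+ j.+1 * sin e = c * (1 - r ^+ 4) * (r ^+ j.+1 * sin e).
    by rewrite c_ofE // mul1r.
  by ring.
have E5 : r ^+ j.+4.+1 = r ^+ j.+1 * r ^+ 4 by rewrite -exprD addnC.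
rewrite E E5.
suff : 0 <= r ^+ j.+1 * sin e + r * sin (j%:R * e - e) by lra.
(* For j = 0 the two terms cancel: f2 w_2 lies on the line of the edge from z_0. *)
case: j jk {E E5} => [|j] jk; first by rewrite mul0r sub0r sinN expr1; lra.
apply: addr_ge0.
  by apply: mulr_ge0; [apply: exprn_ge0; exact: ltW|exact: ltW].
apply: mulr_ge0; first exact: ltW.
have jM : j.+1%:R <= M - 2.
  by rewrite lerBrDr -natrD ler_nat addn2 ltnW.
have j0 : 1 <= j.+1%:R :> R by rewrite ler1n.
by apply: sin_ge0_pi; have := ke_ub; nra.
Qed.

(** Each edge angle t is tested at a vertex whose normal cone contains t - e; the case splits choose
    between neighbouring vertices. *)
Lemma HP_f1 z : HP z -> HP (f1 e z).
Proof.
move=> hz.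
have pi0 := pi_gt0 R; have m4 := M4; have hl := ke_lb; have hu := ke_ub.
have he' := he; have /andP[e0 e3] := he.
have /andP[a1 a2] := A_open; have /andP[a3 a4] := A_closed; have r0 := absa_gt0 he.
have Me : 4 * e <= M * e by rewrite ler_pM2r.
have kE : k.-1%:R = M - 1 by rewrite -subn1 natrB // ltnW.
have kS : k.-1.+1 = k by rewrite prednK // (ltnW k_gt1).
have k1k : (k.-1 < k)%N by rewrite kS.
have k3E : (k - 3)%:R = M - 3 by rewrite natrB // ltnW.
have k3S : (k - 3).+3 = k by rewrite -[RHS](@subnK 3 k) ?addn3 // ltnW.
have k3S2 : (k - 3).+2 = k.-1 by rewrite -[in RHS]k3S.
have hP0 v : HP v -> height (pi - e) v <= height (pi - e) (bj e 0).
  by move=> /(_ 0%N); rewrite size_vertex_list; apply.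
have hPw v : HP v -> height (0%:R * e) v <= height (0%:R * e) (wj e 1).
  move=> /(_ k.+2); rewrite size_vertex_list => /(_ ltac:(idx)).
  rewrite -[k.+2]addn0 edge_al_w // nth_vertex_w; last exact: ltnW k_gt1.
  by rewrite addrC !heightD2pi.
apply: HP_intro.
(* Up to a full turn t - e is 3 pi - 2 e: in the cone of w_k if k e <= pi, otherwise in that of
   w_{k-1}. *)
- have [h|h] := leP (M * e) pi.
    apply: (@height_f1_le _ (pi - e - e + pi *+ 2) (wj e k)); first by right.
      by apply: cone_wk => //; lra.
    rewrite height_f1_wj // subrK sinpi mulr0 subr0.
    exact: height_wk1_b0.
  apply: (@height_f1_le _ (pi - e - e + pi *+ 2) (wj e (k - 3).+2)); first by right.
    by apply: cone_w; [rewrite k3S|rewrite k3E; lra|].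
  rewrite height_f1_wj // subrK sinpi mulr0 subr0.
  by apply: hP0; apply: HP_w; rewrite k3S2.
- move=> j jk.
  apply: (@height_f1_le _ (pi + j%:R * e - e) (zj e j)); first by left.
    by apply: cone_z => //; lra.
  by rewrite f1_zj height_z_edge_next.
- have [h|h] := leP (A - e) (pi + (M - 1) * e).
    apply: (@height_f1_le _ (A - e) (zj e k.-1)); first by left.
      by apply: cone_z => //; rewrite kE; lra.
    by rewrite f1_zj kS.
  apply: (@height_f1_le _ (A - e) (zj e k)); first by left.
    by apply: cone_zk => //; lra.
  by rewrite f1_zj; exact: height_zk1_A.
- case=> [_|i ik].
    have [h|h] := leP (M * e) pi.
      apply: (@height_f1_le _ (0%:R * e - e + pi *+ 2) (zj e k)); first by right.
        by apply: cone_zk => //; lra.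
      by rewrite f1_zj mul0r; exact: height_zk1_top.
    apply: (@height_f1_le _ (0%:R * e - e + pi *+ 2) (zj e k.-1)); first by right.
      by apply: cone_z => //; rewrite kE; lra.
    by rewrite f1_zj kS; apply: hPw; exact: HP_z.
  have iM : i.+1%:R <= M - 2.
    by rewrite lerBrDr -natrD ler_nat addn2.
  apply: (@height_f1_le _ (i.+1%:R * e - e + pi *+ 2) (wj e i.+1)); first by right.
    case: i ik iM => [|i] ik iM; first by apply: cone_w1 => //; lra.
    by apply: cone_w => //; [exact: ltnW|rewrite -!natr1; lra].
  (* The translation in [height_f1_wj] lowers the height since sin (t + e) >= 0; for the last edge
     this reads - sin A >= 0. *)
  rewrite height_f1_wj //.
  have : 0 <= sin (i.+1%:R * e + e).
    apply: sin_ge0_pi; have : 0 <= i.+1%:R :> R by [].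
    by nra.
  by nra.
- have [h|h] := leP (A + pi - e - e) (pi *+ 2 + (M - 2) * e).
    apply: (@height_f1_le _ (A + pi - e - e) (wj e (k - 3).+2)); first by left.
      by apply: cone_w; [rewrite k3S|rewrite k3E; lra|].
    rewrite height_f1_wj // k3S subrK sinDpi.
    have : sin A <= 0.
      by rewrite -[A](subrK (pi *+ 2)) sinD2pi; apply: sin_le0_Npi; lra.
    by nra.
  apply: (@height_f1_le _ (A + pi - e - e) (wj e k)); first by left.
    by apply: cone_wk => //; lra.
  rewrite height_f1_wj // subrK sinDpi.
  have : sin A <= 0.
    by rewrite -[A](subrK (pi *+ 2)) sinD2pi; apply: sin_le0_Npi; lra.
  by have := height_wk1_B; nra.
Qed.

(** Each edge angle t is tested at a vertex whose normal cone contains t + e + pi. Except for the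
    edges from z_0, ..., z_{k-1}, its image is an end of the edge. *)
Lemma HP_f2 z : HP z -> HP (f2 e z).
Proof.
move=> hz.
have pi0 := pi_gt0 R; have m4 := M4; have hl := ke_lb; have hu := ke_ub.
have he' := he; have /andP[e0 e3] := he.
have /andP[a1 a2] := A_open; have /andP[a3 a4] := A_closed; have r0 := absa_gt0 he.
have Me : 4 * e <= M * e by rewrite ler_pM2r.
have k0 : (0 < k)%N := ltnW k_gt1.
have kE : k.-1%:R = M - 1 by rewrite -subn1 natrB // ltnW.
have kS : k.-1.+1 = k by rewrite prednK.
have k2E : (k - 2)%:R = M - 2 by rewrite natrB // ltnW.
have k2S : (k - 2).+2 = k by rewrite -[RHS](@subnK 2 k) ?addn2.
have k2S1 : (k - 2).+1 = k.-1 by rewrite -[in RHS]k2S.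
have hPz j v : (j < k)%N -> HP v ->
    height (pi + j%:R * e) v <= height (pi + j%:R * e) (zj e j).
  move=> jk /(_ j.+1); rewrite size_vertex_list => /(_ ltac:(idx)).
  by rewrite edge_al_z // nth_vertex_z // ltnW.
apply: HP_intro.
- apply: (@height_f2_le _ (pi *+ 2) (wj e 1)).
  + by left; ring.
  + by apply: cone_w1 => //; lra.
  + by rewrite f2_w1.
- move=> j jk.
  have [jk2|] := ltnP j.+2 k.
    apply: (@height_f2_le _ (pi *+ 2 + (j%:R + 1) * e) (wj e j.+2)).
    + by left; ring.
    + by apply: cone_w => //; nra.
    + exact: height_f2w_le.
  rewrite leq_eqVlt => /orP[/eqP kj|kj].
    have jE : j%:R = M - 2 by rewrite kj -!natr1; ring.
    have zE : height (pi + j%:R * e) (zj e j) = c * r ^+ k.-1 * sin e.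
      by rewrite height_z_edge kj.
    (* The angle 2 pi + (k - 1) e is in the cone of b_0 if k e <= pi; otherwise it is past 3 pi - e,
       in the cone of z_0. *)
    rewrite zE jE; have [h|h] := leP (M * e) pi.
      apply: (@height_f2_le _ (pi *+ 2 + (M - 1) * e) (bj e 0)).
      + by left; ring.
      + by apply: cone_b0 => //; lra.
      + exact: height_f2b0_le.
    apply: (@height_f2_le _ ((M - 1) * e) (zj e 0)).
    + by right; ring.
    + by apply: cone_z => //; lra.
    + by rewrite f2_zj; exact: height_w0_k1.
  have {kj} kj : j.+1 = k by apply/eqP; rewrite eqn_leq jk -ltnS kj.
  have jE : j%:R = M - 1 by rewrite -kj -natr1; ring.
  (* A full turn removed, the angle is k e: in the cone of z_0 up to pi, in that of z_1 beyond. *)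
  have [h|h] := leP (M * e) pi.
    have -> : height (pi + j%:R * e) (zj e j) = c * r ^+ k * sin e.
      by rewrite height_z_edge kj.
    rewrite jE; apply: (@height_f2_le _ (M * e) (zj e 0)).
    + by right; ring.
    + by apply: cone_z => //; lra.
    + by rewrite f2_zj; exact: height_w0_k.
  apply: (@height_f2_le _ (M * e) (zj e 1)).
  + by right; rewrite jE; ring.
  + by apply: cone_z => //; lra.
  + by rewrite f2_zj; apply: hPz => //; exact: HP_w.
(* The bounds 2 pi - e <= A < 2 pi put A + e - pi in the cone of z_1, and f2 z_1 = w_1. *)
- apply: (@height_f2_le _ (A + e - pi) (zj e 1)).
  + by right; ring.
  + by apply: cone_z => //; lra.
  + by rewrite f2_zj edge_zkw1 heightD height_polar subrr sin0 mulr0 addr0.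
- move=> i ik.
  apply: (@height_f2_le _ (pi + i.+1%:R * e) (zj e i.+1)).
  + by left; rewrite -natr1; ring.
  + by apply: cone_z => //; lra.
  + by rewrite f2_zj.
- apply: (@height_f2_le _ A (zj e k)).
  + by right; ring.
  + by apply: cone_zk => //; lra.
  + by rewrite f2_zj.
Qed.

End Vertices.

(** * The attractor *)

Section Attractor.
Context {R : realType}.
Variables (e : R) (K : set (R * R)%type).
Hypothesis he : 0 < e < pi / 3.
Hypothesis K_compact : compact K.
Hypothesis K_eq : K = (f1 e @` K) `|` (f2 e @` K).
Local Notation r := (absa e).

Let cvg_absaX : (fun n => r ^+ n : R) @ \oo --> (0 : R).
Proof.
by apply: cvg_expr; rewrite ger0_norm ?absa_lt1 //; exact/ltW/absa_gt0.
Qed.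

Let K_f1 z : K z -> K (f1 e z).
Proof. by move=> Kz; rewrite K_eq; left; exists z. Qed.

Let K_f2 z : K z -> K (f2 e z).
Proof. by move=> Kz; rewrite K_eq; right; exists z. Qed.

(** Uniformity in t matters because [f1] and [f2] shift the angle. *)
Lemma height_bounded p0 : exists B : R, forall t z, K z -> height t z - height t p0 <= B.
Proof.
have [M [_ MK]] := compact_bounded K_compact.
pose m := M + 1.
have hm z : K z -> `|z| <= m by apply: MK; rewrite ltrDl.
exists (m + m + `|p0.1| + `|p0.2|) => t z Kz.
have := hm z Kz; rewrite {1}/Num.norm /= ge_max => /andP[h1 h2].
have tri (s x : R) : `|s| <= 1 -> s * x <= `|x| /\ - (s * x) <= `|x|.
  move=> hs; have : `|s * x| <= `|x| by rewrite normrM ler_piMl.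
  by rewrite ler_norml; lra.
have [a1 _] := tri (sin t) z.1 (sin_max t).
have [a2 _] := tri (cos t) z.2 (cos_max t).
have [_ a3] := tri (sin t) p0.1 (sin_max t).
have [_ a4] := tri (cos t) p0.2 (cos_max t).
by rewrite /height; lra.
Qed.

(** A point of K is an n-fold image of a point of K; the same n maps applied to p0 give a point of P
    whose heights are within |a|^n B. *)
Lemma attractor_height_le (P : set (R * R)%type) p0 :
  P p0 -> (forall z, P z -> P (f1 e z)) -> (forall z, P z -> P (f2 e z)) ->
  forall t h, (forall q, P q -> height t q <= h) ->
  forall z, K z -> height t z <= h.
Proof.
move=> Pp0 P1 P2 t h hP z Kz; have r0 := absa_gt0 he.
have [B hB] := height_bounded p0.
have approx n : forall y, K y -> exists2 q, P q &
    forall s, height s y - height s q <= r ^+ n * B.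
  elim: n => [|n IH] y Ky; first by exists p0 => // s; rewrite mul1r; exact: hB.
  have := Ky; rewrite K_eq => -[] [x Kx <-]; have [q Pq hq] := IH x Kx.
    exists (f1 e q) => [|s]; first exact: P1.
    by rewrite !height_f1 -mulrBr exprS -mulrA ler_pM2l.
  exists (f2 e q) => [|s]; first exact: P2.
  (* [f2] reverses heights, so the one-sided estimate is used at the opposite angle. *)
  have := hq (s + e + pi); rewrite !heightDpi !height_f2 exprS -mulrA.
  by rewrite -(ler_pM2l r0); lra.
rewrite -subr_le0 leNgt; apply/negP => d0.
have cB : (fun n => r ^+ n * B) @ \oo --> (0 * B : R).
  by apply: cvgM; [exact: cvg_absaX|exact: cvg_cst].
rewrite mul0r in cB.
have /cvgrPdist_lt/(_ _ d0) [N _ /(_ N (leqnn N))] := cB.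
rewrite /= sub0r normrN => hN.
have [q Pq hq] := approx N z Kz.
have := hq t; have := hP q Pq; have := ler_norm (r ^+ N * B); lra.
Qed.

(* z_0 is the fixed point of z |-> f2 (f2 (f1 (f1 z))) = a + |a|^4 z. *)
Lemma attractor_z0 : K !=set0 -> K (zj e 0).
Proof.
move=> [x0 Kx0].
pose F z := f2 e (f2 e (f1 e (f1 e z))).
(* The four angle shifts cancel: F contracts every height by |a|^4 without rotation. *)
have FB t x y : height t (F x) - height t (F y) = r ^+ 4 * (height t x - height t y).
  rewrite /F !height_f2 !height_f1 (_ : t + e + e - e - e = t); last by ring.
  by ring.
have Fz : F (zj e 0) = zj e 0.
  rewrite /F !f1_zj f2_zj; apply: height_ext => t.
  rewrite height_f2_wj height_zj mul1r (_ : t + e - 2%:R * e = t - e); last by ring.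
  rewrite (sin_rec he t).
  have := c_ofE he => cE.
  have E : r * sin (t - e) = c_of e * (1 - r ^+ 4) * (r * sin (t - e)) by rewrite cE mul1r.
  apply: (@eq_trans _ _ (r * sin (t - e) + c_of e * r ^+ 5 * sin (t - e))); first by ring.
  by rewrite [X in X + _]E; ring.
pose u n := iter n F x0.
have Ku n : K (u n) by elim: n => //= n IH; do 2 apply: K_f2; do 2 apply: K_f1.
have uE n t : height t (u n) = height t (zj e 0) + (r ^+ 4) ^+ n * (height t x0 - height t (zj e 0)).
  elim: n => [|n IH]; first by rewrite expr0 /u /=; ring.
  have -> : u n.+1 = F (u n) by [].
  have := FB t (u n) (zj e 0); rewrite Fz IH => h.
  by rewrite -[LHS](subrK (height t (zj e 0))) h (exprSr _ n); ring.
have cl : closed K by apply: compact_closed => //; exact: norm_hausdorff.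
have cvgt t : (fun n => height t (u n)) @ \oo --> height t (zj e 0).
  have -> : (fun n => height t (u n)) = (fun n => height t (zj e 0) +
      (r ^+ 4) ^+ n * (height t x0 - height t (zj e 0))) by apply/funext => n; exact: uE.
  have c4 : (fun n => (r ^+ 4) ^+ n) @ \oo --> (0 : R).
    have r0 := absa_gt0 he; have r1 := absa_lt1 he; apply: cvg_expr.
    by rewrite ger0_norm ?exprn_ilt1 ?exprn_ge0 // ltW.
  rewrite [X in _ --> X](_ : _ = height t (zj e 0) + 0 * (height t x0 - height t (zj e 0))).
    by apply: cvgD; [exact: cvg_cst|apply: cvgM => //; exact: cvg_cst].
  by rewrite mul0r addr0.
apply: (@closed_cvg _ _ \oo _ u K cl); first by apply: nearW => n; exact: Ku.
(* Coordinates are the heights at pi/2 and 0, so convergence of heights gives convergence of the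
   orbit. *)
have p2 (z : R * R) : z = (height (pi / 2) z, height 0 z).
  by rewrite /height cos0 sin0 cos_pihalf sin_pihalf [LHS]surjective_pairing; congr (_, _); ring.
rewrite (p2 (zj e 0)); have -> : u = (fun n => (height (pi / 2) (u n), height 0 (u n))).
  by apply/funext => n; exact: p2.
exact: (cvg_pair (cvgt (pi / 2)) (cvgt 0)).
Qed.

Lemma attractor_vertices k : K !=set0 ->
  [set x | x \in vertex_list e k] `<=` K.
Proof.
move=> K0; have Kz j : K (zj e j).
  by elim: j => [|j IH]; [exact: attractor_z0|rewrite -f1_zj; exact: K_f1].
have Kw j : K (wj e j) by rewrite -f2_zj; exact: K_f2.
move=> x /=; rewrite /vertex_list inE mem_cat => /or3P[/eqP ->|/mapP[j _ ->]|/mapP[j _ ->]] //.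
by rewrite -f2_w1 //; exact: K_f2.
Qed.

End Attractor.

Theorem theorem1p3 (R : realType) (k : nat) (eta eta_k1 eta_k : R)
  (K : set (R * R)%type) :
  (4 <= k)%N ->
  (* eta_{k+1}: the (unique) zero of Phi_{k+1} in (pi/(k+1), pi/k) *)
  pi / k.+1%:R < eta_k1 < pi / k%:R -> Phi k.+1 eta_k1 = 0 ->
  (* eta_k: the (unique) zero of Phi_k in (pi/k, pi/(k-1)) *)
  pi / k%:R < eta_k < pi / (k%:R - 1) -> Phi k eta_k = 0 ->
  eta_k1 <= eta < eta_k ->
  0 < eta < pi / 3 ->
  (* K = K_eta: nonempty compact with K = f1(K) u f2(K) *)
  K !=set0 -> compact K -> K = (f1 eta @` K) `|` (f2 eta @` K) ->
  polygon_cw (conv_hull K) (vertex_list eta k).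
Proof.
move=> k4 h1 P1 h0 P0 hb he K0 Kc KE.
have [lb ub r4 Pk Pk1] := Phi_signs k4 h1 P1 h0 P0 hb.
have [A [rho [A1 A2 rho0 E]]] := edge_angle he k4 lb ub r4 Pk Pk1.
have poly := vertex_list_polygon k4 he lb ub A1 A2 rho0 E.
set HP := halfplanes _ _ in poly.
suff -> : conv_hull K = HP by [].
have [_ hull _ _] := poly.
apply/seteqP; split.
  apply: conv_hull_sub; first by rewrite hull; exact: conv_hull_convex.
  (* Membership in the polygon is a bound on one height per edge, to which [attractor_height_le]
     applies. *)
  move=> z Kz i hi.
  apply: (attractor_height_le he Kc KE (p0 := zj eta 0) (P := HP)) => //.
  - exact: (HP_z k4 he lb ub A1 A2 rho0 E (leq0n k)).
  - exact: (HP_f1 k4 he lb ub A1 A2 rho0 E).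
  - exact: (HP_f2 k4 he lb ub A1 A2 rho0 E).
  - by move=> q; apply.
rewrite hull; apply: conv_hull_sub; first exact: conv_hull_convex.
by apply: subset_trans (@sub_conv_hull _ _); exact: attractor_vertices.
Qed.
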